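(* Let $(\mathcal L_s)_{s\in(0,1]}$ be a family of operators satisfying assumptions (A0)–(A5) of the context. Let $\lambda\notin\Sigma(\mathcal L_1)$, $g\in L^2(\Omega)$ and $h\in L^\infty(\partial\Omega)$. For $s<1$ close to $1$ let $v_s=\mathbb M_{\mathcal L_s}(h)+\mathbb G_{\mathcal L_s-\lambda}\big(g+\lambda\mathbb M_{\mathcal L_s}(h)\big)$ be the solution of $\mathcal L_sv-\lambda v=g$ in $\Omega$, $B_sv=h$ on $\partial\Omega$. Then, as $s\to1^-$, $v_s$ converges weakly in $L^1(\Omega)$ to $$v_1=\mathbb M_{\mathcal L_1}(h)+\mathbb G_{\mathcal L_1-\lambda}\big(g+\lambda\mathbb M_{\mathcal L_1}(h)\big).$$
   Context: Setting. $\Omega\subset\mathbb R^n$ is bounded of class $C^{1,1}$, $\delta(x)=\mathrm{dist}(x,\partial\Omega)$. $f\asymp g$ means $C^{-1}f\le g\le Cf$ for a constant $C>0$; $a\wedge b=\min\{a,b\}$. For each $s\in(0,1]$, $\mathcal L_s$ is a non-negative operator of order $2s$ with homogeneous Dirichlet condition, entering through its Green function $\mathcal G_{\mathcal L_s}$. (A0) For all $s\in(0,1]$, $\mathcal L_s$ satisfies, with some $\gamma=\gamma(s)\in(0,1]$ and constants possibly depending on $s$: (K1) $\mathcal G_{\mathcal L_s}:(\Omega\times\Omega)\setminus\{x=y\}\to(0,\infty)$, $\mathcal G_{\mathcal L_s}(x,y)=\mathcal G_{\mathcal L_s}(y,x)\asymp|x-y|^{-(n-2s)}\left(\frac{\delta^\gamma(x)\delta^\gamma(y)}{|x-y|^{2\gamma}}\wedge1\right)$,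 $n\ne2s$; (K2) $D_\gamma\mathcal G_{\mathcal L_s}(z,x)=\lim_{\Omega\ni y\to z}\mathcal G_{\mathcal L_s}(y,x)/\delta^\gamma(y)$ exists for $z\in\partial\Omega$, $x\in\Omega$, and is $\asymp\delta^\gamma(x)|x-z|^{-(n-2s+2\gamma)}$. Operators: $\mathbb G_{\mathcal L_s}(f)(x)=\int_\Omega\mathcal G_{\mathcal L_s}(x,y)f(y)\,dy$, compact and self-adjoint on $L^2(\Omega)$; standing: there are $0<\lambda_1(\mathcal L_s)\le\lambda_2(\mathcal L_s)\le\dots\to\infty$ and an $L^2$-orthonormal basis $(\varphi_j)$ (depending on $s$) with $\varphi_j=\lambda_j(\mathcal L_s)\mathbb G_{\mathcal L_s}(\varphi_j)$. $\Sigma(\mathcal L_s)=\{\lambda_j(\mathcal L_s)\}$. For $\lambda\notin\Sigma(\mathcal L_s)$, $\mathbb G_{\mathcal L_s-\lambda}(f)=\sum_j\frac{\langle f,\varphi_j\rangle}{\lambda_j(\mathcal L_s)-\lambda}\varphi_j$ for $f\in L^2(\Omega)$, extended by continuity to $\{f:f\delta^{\gamma(s)}\in L^1(\Omega)\}$ with norm $\|f\delta^{\gamma(s)}\|_{L^1(\Omega)}$. Martin operator: $\mathbb M_{\mathcal L_s}(h)(x)=\int_{\partial\Omega}D_\gamma\mathcal G_{\mathcal L_s}(z,x)h(z)\,d\mathcal H^{n-1}(z)$. ($B_sv=h$ means that $v$ has weighted trace $h$: formally $\lim_{x\to z}v(x)/\mathbb M_{\mathcal L_s}(1)(x)=h(z)$.)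 (A1) $\|\mathbb G_{\mathcal L_s}(f)-\mathbb G_{\mathcal L_1}(f)\|_{L^2(\Omega)}\le\omega(1-s)\|f\|_{L^2(\Omega)}$ for all $f\in L^2(\Omega)$, where $\omega(1-s)\searrow0$ as $s\to1$. (This implies $\lambda\notin\Sigma(\mathcal L_s)$ for $s$ close to $1$ whenever $\lambda\notin\Sigma(\mathcal L_1)$.) (A2) $2s>\gamma(s)$ for $s$ sufficiently close to $1$. (A3) $\mathbb M_{\mathcal L_s}(h)\to\mathbb M_{\mathcal L_1}(h)$ in $L^1(\Omega)$ as $s\to1$, for all $h\in L^\infty(\partial\Omega)$. (A4) $\|\mathbb G_{\mathcal L_s-\lambda}(f)\|_{L^{n/(n-1)}(\Omega)}\le C(\lambda)\|f\|_{L^1(\Omega)}$ and (A5) $\|\mathbb G_{\mathcal L_s-\lambda}(f)\|_{L^\infty(\Omega)}\le C(\lambda)\|f\|_{L^\infty(\Omega)}$, where, for $\lambda\notin\Sigma(\mathcal L_1)$, $C(\lambda)$ does not depend on $s$ close to $1$. *)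

(* Defs.v *)
From HB Require Import structures.
From mathcomp Require Export all_boot all_order all_algebra.
From mathcomp Require Export all_classical all_reals all_analysis.
Export Order.TTheory GRing.Theory Num.Theory.
Export numFieldNormedType.Exports.

Set Implicit Arguments.
Unset Strict Implicit.
Unset Printing Implicit Defensive.

Global Open Scope classical_set_scope.
Global Open Scope ring_scope.

(* T with every subset measurable: for a cost c : set T -> \bar R, the library's
   mu_ext c on this type is the infimum of \sum_k c (C k) over all countable
   covers C, and a cover is made unusable by giving it the cost +oo. *)
Definition all_sets (T : pointedType) : Type := T.

HB.instance Definition _ (T : pointedType) := Pointed.on (all_sets T).

Fact all_sets_display : measure_display. Proof. exact: default_measure_display. Qed.

HB.instance Definition _ (T : pointedType) :=
  @isMeasurable.Build all_sets_display (all_sets T) setT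
    I (fun _ _ => I) (fun _ _ => I).

Definition cover_outer (R : realType) (T : pointedType) (c : set T -> \bar R)
  (A : set T) : \bar R := @mu_ext _ (all_sets T) R c A.

Section cover_outer_theory.
Context (R : realType) (T : pointedType) (c : set T -> \bar R).
Hypotheses (c0 : c set0 = 0%E) (c_ge0 : forall C, (0 <= c C)%E).

Lemma cover_outer0 : cover_outer c set0 = 0%E.
Proof. by apply: (@mu_ext0 _ (all_sets T)). Qed.

Lemma cover_outer_ge0 A : (0 <= cover_outer c A)%E.
Proof. by apply: (@mu_ext_ge0 _ (all_sets T)). Qed.

Lemma le_cover_outer : {homo cover_outer c : A B / A `<=` B >-> (A <= B)%E}.
Proof. exact: (@le_mu_ext _ (all_sets T)). Qed.

Lemma cover_outer_sigma_subadditive : sigma_subadditive (cover_outer c).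
Proof. by apply: (@mu_ext_sigma_subadditive _ (all_sets T)). Qed.

End cover_outer_theory.

Definition caratheodory_measure_of (R : realType) (T : pointedType)
    (mu : {outer_measure set T -> \bar R}) :
    {measure set (caratheodory_type mu) -> \bar R} :=
  mu : set (caratheodory_type mu) -> \bar R.

Section lebesgue.
Context (R : realType) (n : nat).

Definition box (a b : 'rV[R]_n.+1) : set 'rV[R]_n.+1 :=
  [set x | forall j, a 0 j <= x 0 j < b 0 j].

Definition box_volume (a b : 'rV[R]_n.+1) : R :=
  \prod_j Num.max (b 0 j - a 0 j) 0.

(* +oo when C is not a box *)
Definition box_cost (C : set 'rV[R]_n.+1) : \bar R :=
  ereal_inf [set (box_volume ab.1 ab.2)%:E
            | ab in [set ab | C = box ab.1 ab.2]].

Lemma box_cost_ge0 C : (0 <= box_cost C)%E.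
Proof.
apply: le_ereal_inf_tmp => _ [[a b] _ <-]; rewrite lee_fin.
by apply: prodr_ge0 => j _; rewrite le_max lexx orbT.
Qed.

Lemma box_cost0 : box_cost set0 = 0%E.
Proof.
apply/eqP; rewrite eq_le box_cost_ge0 andbT.
apply: ereal_inf_lbound; exists (0, 0) => /=.
  apply/seteqP; split => [x []|x /(_ ord0)].
  by rewrite mxE => /andP[x0 /(le_lt_trans x0)]; rewrite ltxx.
rewrite /box_volume (bigD1 ord0)//= !mxE subrr.
by rewrite (_ : Num.max 0 0 = 0 :> R) ?mul0r// maxxx.
Qed.

Definition lebesgue_outer : set 'rV[R]_n.+1 -> \bar R := cover_outer box_cost.

HB.instance Definition _ := isOuterMeasure.Build R 'rV[R]_n.+1 lebesgue_outer
  (cover_outer0 box_cost0 box_cost_ge0)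
  (cover_outer_ge0 box_cost_ge0)
  (@le_cover_outer _ _ _)
  (cover_outer_sigma_subadditive box_cost_ge0).

(* 'rV[R]_n.+1 with the sigma-algebra of Lebesgue measurable sets *)
Definition lebesgue_mspace : measurableType lebesgue_outer.-cara :=
  caratheodory_type [the {outer_measure set _ -> \bar R} of lebesgue_outer].

Definition lebesgue_measure_rV : {measure set lebesgue_mspace -> \bar R} :=
  caratheodory_measure_of lebesgue_outer.

End lebesgue.

(* The library norm of 'rV[R]_n is the maximum norm. *)
Definition enorm (R : realType) (n : nat) (x : 'rV[R]_n) : R :=
  Num.sqrt (\sum_j x 0 j ^+ 2).

(* Volume pi^(d/2) / Gamma(d/2 + 1) of the Euclidean unit ball of R^d *)
Fixpoint unit_ball_volume (R : realType) (d : nat) : R :=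
  match d with
  | 0%N => 1
  | 1%N => 2
  | d'.+2 => 2 * pi / d%:R * unit_ball_volume R d'
  end.

Section hausdorff.
Context (R : realType) (n d : nat).

Definition diameter (C : set 'rV[R]_n) : \bar R :=
  ereal_sup [set (enorm (xy.1 - xy.2))%:E | xy in C `*` C].

Definition hausdorff_cost (e : R) (C : set 'rV[R]_n) : \bar R :=
  if `[< C = set0 >] then 0%E
  else if (diameter C <= e%:E)%E
  then (unit_ball_volume R d * (fine (diameter C) / 2) ^+ d)%:E
  else +oo%E.

Lemma unit_ball_volume_ge0 k : 0 <= unit_ball_volume R k.
Proof.
have [m] := ubnP k; elim: m k => // m IH [|[|k]] //= km.
by rewrite mulr_ge0 ?divr_ge0 ?mulr_ge0 ?pi_ge0// IH// ltnW.
Qed.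

Lemma hausdorff_cost0 e : hausdorff_cost e set0 = 0%E.
Proof. by rewrite /hausdorff_cost; case: asboolP. Qed.

Lemma hausdorff_cost_ge0 e C : (0 <= hausdorff_cost e C)%E.
Proof.
rewrite /hausdorff_cost; case: asboolP => // /eqP/set0P[x Cx].
case: ifP => // _; rewrite lee_fin mulr_ge0 ?unit_ball_volume_ge0//.
rewrite exprn_ge0// divr_ge0// fine_ge0//.
apply: ereal_sup_ubound; exists (x, x) => //=.
by rewrite subrr /enorm big1 ?sqrtr0// => j _; rewrite mxE expr0n.
Qed.

(* d-dimensional Hausdorff measure in R^n, normalized so that it is the Lebesgue
   measure when d = n *)
Definition hausdorff_outer (A : set 'rV[R]_n) : \bar R :=
  ereal_sup [set cover_outer (hausdorff_cost e) A | e in [set e | 0 < e]].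

Lemma le_cover_hausdorff e A : 0 < e ->
  (cover_outer (hausdorff_cost e) A <= hausdorff_outer A)%E.
Proof. by move=> e0; apply: ereal_sup_ubound; exists e. Qed.

Lemma hausdorff_outer_ge0 A : (0 <= hausdorff_outer A)%E.
Proof.
apply: le_trans (le_cover_hausdorff A ltr01).
exact: cover_outer_ge0 (hausdorff_cost_ge0 _) _.
Qed.

Lemma hausdorff_outer0 : hausdorff_outer set0 = 0%E.
Proof.
apply/eqP; rewrite eq_le hausdorff_outer_ge0 andbT.
apply: ge_ereal_sup => _ [e _ <-].
by rewrite (cover_outer0 (hausdorff_cost0 e) (hausdorff_cost_ge0 e)).
Qed.

Lemma le_hausdorff_outer :
  {homo hausdorff_outer : A B / A `<=` B >-> (A <= B)%E}.
Proof.
move=> A B AB; apply: ge_ereal_sup => _ [e e0 <-].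
by apply: le_trans (le_cover_hausdorff B e0); exact: le_cover_outer.
Qed.

Lemma hausdorff_outer_sigma_subadditive : sigma_subadditive hausdorff_outer.
Proof.
move=> F; apply: ge_ereal_sup => _ [e e0 <-].
have := cover_outer_sigma_subadditive
  (hausdorff_cost_ge0 e) F.
move=> /le_trans; apply; apply: lee_nneseries => [i _ _|i _].
  exact: cover_outer_ge0 (hausdorff_cost_ge0 e) _.
exact: le_cover_hausdorff.
Qed.

HB.instance Definition _ := isOuterMeasure.Build R 'rV[R]_n hausdorff_outer
  hausdorff_outer0 hausdorff_outer_ge0 le_hausdorff_outer
  hausdorff_outer_sigma_subadditive.

Definition hausdorff_mspace : measurableType hausdorff_outer.-cara :=
  caratheodory_type [the {outer_measure set _ -> \bar R} of hausdorff_outer].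

Definition hausdorff_measure : {measure set hausdorff_mspace -> \bar R} :=
  caratheodory_measure_of hausdorff_outer.

End hausdorff.

Definition boundary (T : topologicalType) (A : set T) : set T :=
  closure A `\` interior A.

(* The partial derivatives dg of g exist everywhere and are Lipschitz. *)
Definition C11_function (R : realType) (n : nat) (g : 'rV[R]_n -> R) : Prop :=
  exists dg : 'rV[R]_n -> 'rV[R]_n,
    (forall (x : 'rV[R]_n) j, is_derive (0 : R) (1 : R)
       (fun t : R => g (x + t *: delta_mx 0 j)) (dg x 0 j)) /\
    exists K : R, forall x y : 'rV[R]_n, enorm (dg x - dg y) <= K * enorm (x - y).

(* Near each boundary point, after an orthogonal change U of coordinates, Om is
   the region above the graph of a C^{1,1} function of the first n coordinates. *)
Definition C11_domain (R : realType) (n : nat) (Om : set 'rV[R]_n.+1) : Prop :=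
  open Om /\
  forall z : 'rV[R]_n.+1, boundary Om z ->
    exists r : R, 0 < r /\
    exists U : 'M[R]_n.+1, U *m U^T = 1%:M /\
    exists g : 'rV[R]_n -> R, C11_function g /\
      forall x : 'rV[R]_n.+1, enorm (x - z) < r ->
        (Om x <-> g (col' ord_max (x *m U)) < (x *m U) 0 ord_max).

Definition bdist (R : realType) (n : nat) (Om : set 'rV[R]_n)
    (x : 'rV[R]_n) : R :=
  inf [set enorm (x - z) | z in boundary Om].

Section function_spaces.
Context (R : realType) (n : nat) (Om : set 'rV[R]_n.+1).
Implicit Types (f g u : 'rV[R]_n.+1 -> R) (p : \bar R).

Definition inLp p f : Prop :=
  (f \_ Om : lebesgue_mspace R n -> R) \in Lfun (lebesgue_measure_rV R n) p.

Definition normLp p f : \bar R :=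
  Lnorm (lebesgue_measure_rV R n) p (EFin \o (f \_ Om)).

Definition dotL2 f g : R := \int[lebesgue_measure_rV R n]_(x in Om) (f x * g x).

Definition inLinfty_boundary (h : 'rV[R]_n.+1 -> R) : Prop :=
  (h \_ (boundary Om) : hausdorff_mspace R n.+1 n -> R)
    \in Lfun (hausdorff_measure R n.+1 n) +oo%E.

Definition cvg_L1 (S : Type) (F : set_system S)
    (v : S -> 'rV[R]_n.+1 -> R) (w : 'rV[R]_n.+1 -> R) : Prop :=
  [/\ \forall s \near F, inLp 1%E (v s), inLp 1%E w &
      normLp 1%E (v s \- w) @[s --> F] --> 0%E].

Definition weak_cvg_L1 (S : Type) (F : set_system S)
    (v : S -> 'rV[R]_n.+1 -> R) (w : 'rV[R]_n.+1 -> R) : Prop :=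
  [/\ \forall s \near F, inLp 1%E (v s), inLp 1%E w &
      forall psi, inLp +oo%E psi ->
        dotL2 (v s) psi @[s --> F] --> dotL2 w psi].

End function_spaces.

Section operators.
Context (R : realType) (n : nat) (Om : set 'rV[R]_n.+1).
Local Notation V := 'rV[R]_n.+1.
Local Notation dim := (n.+1%:R : R).
Local Notation delta := (bdist Om).
Implicit Types (s gam : R) (G : V -> V -> R) (lam : nat -> R)
  (phi : nat -> V -> R).

Definition green_op G (f : V -> R) (x : V) : R :=
  \int[lebesgue_measure_rV R n]_(y in Om) (G x y * f y).

(* For z in the boundary of Om and x in Om; K2 asserts that the limit exists. *)
Definition Dgreen gam G (z x : V) : R :=
  lim ((fun y => G y x / delta y `^ gam) @ within Om (nbhs z)).

Definition martin_op gam G (h : V -> R) (x : V) : R :=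
  \int[hausdorff_measure R n.+1 n]_(z in boundary Om) (Dgreen gam G z x * h z).

Definition comparable2 (A : set (V * V)) (f g : V -> V -> R) : Prop :=
  exists2 C : R, 0 < C &
    forall x y, A (x, y) -> C^-1 * g x y <= f x y <= C * g x y.

Definition off_diagonal : set (V * V) :=
  [set xy | [/\ Om xy.1, Om xy.2 & xy.1 <> xy.2]].

Definition K1 s gam G : Prop :=
  [/\ dim != 2 * s,
      forall x y, off_diagonal (x, y) -> 0 < G x y,
      forall x y, off_diagonal (x, y) -> G x y = G y x &
      comparable2 off_diagonal G (fun x y =>
        enorm (x - y) `^ (- (dim - 2 * s)) *
        Num.min (delta x `^ gam * delta y `^ gam / enorm (x - y) `^ (2 * gam)) 1)].

Definition K2 s gam G : Prop :=
  (forall z x : V, boundary Om z -> Om x ->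
     cvg ((fun y => G y x / delta y `^ gam) @ within Om (nbhs z))) /\
  comparable2 (boundary Om `*` Om) (Dgreen gam G) (fun z x =>
    delta x `^ gam * enorm (x - z) `^ (- (dim - 2 * s + 2 * gam))).

Definition compact_selfadjoint_L2 (T : (V -> R) -> V -> R) : Prop :=
  [/\ forall f, inLp Om 2%:E f -> inLp Om 2%:E (T f),
      forall f g, inLp Om 2%:E f -> inLp Om 2%:E g ->
        dotL2 Om (T f) g = dotL2 Om f (T g) &
      forall (f : nat -> V -> R) (M : R),
        (forall k, inLp Om 2%:E (f k)) ->
        (forall k, (normLp Om 2%:E (f k) <= M%:E)%E) ->
        exists (e : nat -> nat) (u : V -> R),
          [/\ forall k, (e k < e k.+1)%N, inLp Om 2%:E u &
              normLp Om 2%:E (T (f (e k)) \- u) @[k --> \oo] --> 0%E]].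

(* lam j and phi j stand for lambda_(j+1) and varphi_(j+1). *)
Definition eigenbasis G lam phi : Prop :=
  [/\ 0 < lam 0%N /\ (forall j, lam j <= lam j.+1),
      lam j @[j --> \oo] --> +oo,
      (forall j, inLp Om 2%:E (phi j)) /\
      (forall i j, dotL2 Om (phi i) (phi j) = (i == j)%:R),
      forall f, inLp Om 2%:E f ->
        normLp Om 2%:E
          (f \- (fun x => \sum_(j < N) dotL2 Om f (phi j) * phi j x))
          @[N --> \oo] --> 0%E &
      forall j, {ae lebesgue_measure_rV R n, forall x : lebesgue_mspace R n, Om x ->
        phi j x = lam j * green_op G (phi j) x}].

Definition spectrum lam : set R := range lam.

(* u = \sum_j <f, varphi_j> / (lambda_j - l) varphi_j in L^2(Om) *)
Definition is_resolvent_L2 lam phi (l : R) (f u : V -> R) : Prop :=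
  inLp Om 2%:E u /\
  normLp Om 2%:E
    (u \- (fun x => \sum_(j < N) dotL2 Om f (phi j) / (lam j - l) * phi j x))
    @[N --> \oo] --> 0%E.

(* Functions stand for their a.e. classes; get picks a representative. *)
Definition resolvent_L2 lam phi l (f : V -> R) : V -> R :=
  get [set u | is_resolvent_L2 lam phi l f u].

(* u is the value at f of the extension by continuity of the L^2 resolvent, from
   the norm of f delta^gam in L^1(Om) to the norm of L^1(Om). *)
Definition is_resolvent_ext gam lam phi l (f u : V -> R) : Prop :=
  inLp Om 1%E u /\
  forall fk : nat -> V -> R,
    (forall k, inLp Om 2%:E (fk k)) ->
    normLp Om 1%E (fun x => (fk k x - f x) * delta x `^ gam)
      @[k --> \oo] --> 0%E ->
    normLp Om 1%E (resolvent_L2 lam phi l (fk k) \- u) @[k --> \oo] --> 0%E.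

Definition resolvent gam lam phi l (f : V -> R) : V -> R :=
  if `[< inLp Om 2%:E f >] then resolvent_L2 lam phi l f
  else get [set u | is_resolvent_ext gam lam phi l f u].

End operators.

(* L_s is given by its Green function, its exponent gamma(s) and an
   L^2-orthonormal basis of eigenfunctions. *)
Record op_family (R : realType) (n : nat) := OpFamily {
  green : R -> 'rV[R]_n.+1 -> 'rV[R]_n.+1 -> R;
  gamma : R -> R;
  eigenval : R -> nat -> R;
  eigenfun : R -> nat -> 'rV[R]_n.+1 -> R }.

Section families.
Context (R : realType) (n : nat) (Om : set 'rV[R]_n.+1) (L : op_family R n).

Definition Gop (s : R) := green_op Om (green L s).

Definition Mop (s : R) := martin_op Om (gamma L s) (green L s).

Definition Sigma (s : R) : set R := spectrum (eigenval L s).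

Definition Gres (s l : R) :=
  resolvent Om (gamma L s) (eigenval L s) (eigenfun L s) l.

Definition A0 : Prop := forall s : R, 0 < s <= 1 ->
  [/\ 0 < gamma L s <= 1, K1 Om s (gamma L s) (green L s) &
      K2 Om s (gamma L s) (green L s)].

(* The measurability of the kernel in its second variable, needed for
   green_op to be an integral, and the properties of the Green operator *)
Definition standing : Prop := forall s : R, 0 < s <= 1 ->
  [/\ forall x, Om x -> measurable_fun (Om : set (lebesgue_mspace R n))
        (green L s x : lebesgue_mspace R n -> R),
      compact_selfadjoint_L2 Om (Gop s) &
      eigenbasis Om (green L s) (eigenval L s) (eigenfun L s)].

Definition A1 : Prop :=
  exists omega : R -> R,
    [/\ forall t1 t2 : R, 0 < t1 -> t1 <= t2 -> t2 < 1 -> omega t1 <= omega t2,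
        omega t @[t --> 0^'+] --> 0 &
        forall s : R, 0 < s < 1 -> forall f, inLp Om 2%:E f ->
          (normLp Om 2%:E (Gop s f \- Gop 1 f)%R
             <= (omega (1 - s))%:E * normLp Om 2%:E f)%E].

Definition A2 : Prop := \forall s \near 1^'-, gamma L s < 2 * s.

Definition A3 : Prop := forall h, inLinfty_boundary Om h ->
  cvg_L1 Om 1^'- (Mop ^~ h) (Mop 1 h).

(* A0 includes n.+1 != 2 * s at s = 1/2 and s = 1, hence 3 <= n.+1 and the
   exponent n.+1 / n is the finite real number of the mathematical statement. *)
Definition A4 : Prop := forall l : R, ~ Sigma 1 l ->
  exists C s0 : R, s0 < 1 /\
    forall s : R, 0 < s -> s0 < s -> s <= 1 -> forall f, inLp Om 1%E f ->
      (normLp Om (n.+1%:R / n%:R)%:E (Gres s l f) <= C%:E * normLp Om 1%E f)%E.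

Definition A5 : Prop := forall l : R, ~ Sigma 1 l ->
  exists C s0 : R, s0 < 1 /\
    forall s : R, 0 < s -> s0 < s -> s <= 1 -> forall f, inLp Om +oo%E f ->
      (normLp Om +oo%E (Gres s l f) <= C%:E * normLp Om +oo%E f)%E.

Definition solution (l : R) (g h : 'rV[R]_n.+1 -> R) (s : R) : 'rV[R]_n.+1 -> R :=
  Mop s h \+ Gres s l (g \+ (fun x => l * Mop s h x)).

End families.

(* Main.v *)
(* Write R_s for the resolvent, K_s for the Green operator of L_s.
   Since R_s is symmetric, <R_s f, psi> = <f, R_s psi> for f in L^2 and psi
   bounded. From the fixed point equation R_s psi = K_s (psi + lambda R_s psi),
   (A5) and the kernel bound K_s 1 = O(delta^gamma), which is where
   gamma(s) < 2 s enters, R_s psi = O(delta^gamma); by duality R_s is bounded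
   from the weighted L^1 norm to L^1, so the extension by continuity exists and
   the same symmetry holds for f in L^1.
   By (A5) the functions R_s psi are uniformly bounded, and subtracting the
   fixed point equations for s and 1, (A1) makes their coefficients in the
   eigenbasis of L_1 converge, so <f, R_s psi> -> <f, R_1 psi> for every f in
   L^1. The theorem follows by testing v_s against psi, as M_s h -> M_1 h in
   L^1. *)
Require Import Defs.
From mathcomp Require Import ring lra measurable_realfun ess_sup_inf hoelder.

Set Implicit Arguments.
Unset Strict Implicit.
Unset Printing Implicit Defensive.

(** Resolvents are picked by [get], which returns a default when nothing meets the specification. So
    existence precedes every estimate: on L^2 it comes from compactness of the Green operator, on
    L^1 from the duality bound. Two kinds of constants are kept apart. The O(delta^gamma) bound uses
    the kernel constants, which may degenerate as s -> 1; it serves, for one fixed s, to extend the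
    resolvent and its symmetry to L^1. What must be uniform in s comes from (A5) and (A1). That
    lambda avoids the spectrum of L_s for s near 1 is proved: an eigenfunction of L_s for lambda
    would nearly be one for the Green operator of L_1, which the gap between lambda and the spectrum
    of L_1 excludes. The coefficient estimate is used for one index at a time and is never summed;
    the tail of the expansion of the function paired with R_s psi is absorbed by the uniform sup
    bound. In <M_s h, R_s psi> both factors move with s; the limit exists because the first
    converges in norm while the second stays bounded. *)

(** * Lebesgue measure on row vectors: open sets, balls, points *)

Section lebesgue_open.
Context (R : realType) (n : nat).
Local Notation V := 'rV[R]_n.+1.
Local Notation outer := (@lebesgue_outer R n).
Local Notation mspace := (lebesgue_mspace R n).

Lemma box_cost_le (a b : V) : (box_cost (box a b) <= (box_volume a b)%:E)%E.
Proof. by apply: ereal_inf_lbound; exists (a, b). Qed.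

(** A hyperplane orthogonal to an axis cuts a box into two boxes that differ from it only in the
    edge [j], and the two new edge lengths sum to at most the old one. If [C] is no box, its cost is
    [+oo]. *)
Lemma box_cost_halfspace (C : set V) (j : 'I_n.+1) (c : R) :
  (box_cost (C `&` [set x : V | (x 0 j < c)%R]) + box_cost (C `&` ~` [set x : V | (x 0 j < c)%R])
   <= box_cost C)%E.
Proof.
apply: le_ereal_inf_tmp => _ [[a b] /= -> <-].
pose b' : V := \row_i (if i == j then Num.min (b 0 j) c else b 0 i).
pose a' : V := \row_i (if i == j then Num.max (a 0 j) c else a 0 i).
have -> : box a b `&` [set x | x 0 j < c] = box a b'.
  apply/seteqP; split => [x [/= xab xc] i|x /= xab].
    rewrite mxE; case: eqP => [->|_]; last exact: xab.
    by rewrite lt_min xc andbT; exact: xab.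
  split => [i|].
    have := xab i; rewrite mxE; case: eqP => [->|//].
    by rewrite lt_min => /andP[-> /andP[->]].
  by have := xab j; rewrite mxE eqxx lt_min => /andP[_ /andP[_]].
have -> : box a b `&` ~` [set x | x 0 j < c] = box a' b.
  apply/seteqP; split => [x [/= xab /negP]|x /= xab].
    rewrite -leNgt => xc i.
    rewrite mxE; case: eqP => [->|_]; last exact: xab.
    by rewrite ge_max xc andbT; exact: xab.
  split => [i|].
    have := xab i; rewrite mxE; case: eqP => [->|//].
    by rewrite ge_max => /andP[/andP[-> _] ->].
  apply/negP; rewrite -leNgt.
  by have := xab j; rewrite mxE eqxx ge_max => /andP[/andP[_ ->]].
apply: (le_trans (leeD (box_cost_le _ _) (box_cost_le _ _))).
rewrite -EFinD lee_fin /box_volume (bigD1 j)//= [X in _ + X](bigD1 j)//=.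
rewrite [leRHS](bigD1 j)//= !mxE !eqxx.
rewrite (eq_bigr (fun i => Num.max (b 0 i - a 0 i) 0)); last first.
  by move=> i ij; rewrite mxE (negbTE ij).
rewrite [X in _ + _ * X <= _](eq_bigr (fun i => Num.max (b 0 i - a 0 i) 0)); last first.
  by move=> i ij; rewrite mxE (negbTE ij).
rewrite -mulrDl ler_wpM2r//.
  by apply: prodr_ge0 => i _; rewrite le_max lexx orbT.
move: (a 0 j) (b 0 j) => u v; rewrite /Num.max /Num.min.
by do ![case: ifPn => //]; rewrite -?leNgt; lra.
Qed.

(** Caratheodory's criterion: cutting every member of a cover of [X] gives covers of the two pieces,
    and by [box_cost_halfspace] their total cost does not exceed that of the original cover. *)
Lemma measurable_halfspace (j : 'I_n.+1) (c : R) :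
  measurable ([set x : V | x 0 j < c] : set mspace).
Proof.
apply: le_caratheodory_measurable => X.
apply: le_ereal_inf_tmp => _ [F [_ XF] <-].
set H := [set x : V | x 0 j < c].
have cov (A : set V) : (outer (X `&` A) <= \sum_(k <oo) box_cost (F k `&` A))%E.
  apply: ereal_inf_lbound; exists (fun k => F k `&` A) => //; split=> //.
  by move=> x [/XF[k _ Fkx] Ax]; exists k.
apply: (le_trans (leeD (cov _) (cov _))).
rewrite -nneseriesD; [|by move=> *; exact: box_cost_ge0..].
apply: lee_nneseries => [k _ _|k _]; first by rewrite adde_ge0 ?box_cost_ge0.
exact: box_cost_halfspace.
Qed.

Lemma measurable_box (a b : V) : measurable (box a b : set mspace).
Proof.
pose F j : set mspace := [set x : V | (x 0 j < b 0 j)%R] `&` ~` [set x : V | (x 0 j < a 0 j)%R].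
rewrite (_ : box a b = ~` (\bigcup_j ~` F j)).
  apply: measurableC; apply: countable_bigcupT_measurable => // j.
  apply/measurableC/measurableI; first exact: measurable_halfspace.
  by apply: measurableC; exact: measurable_halfspace.
rewrite setC_bigcup; apply/seteqP; split => [x xab i _ /=|x xab j].
  move=> nF; apply: nF; have /andP[ax xb] := xab i.
  by split => //; apply/negP; rewrite -leNgt.
by have /contrapT[/= -> /negP] := xab j I; rewrite -leNgt => ->.
Qed.

Lemma measurable_open_rV (U : set V) : open U -> measurable (U : set mspace).
Proof.
move=> oU.
(* Boxes with rational centre and half-edge 1/(k+1) form a countable family; those contained in [U]
   cover it. *)
pose B (q : 'rV[rat]_n.+1 * nat) : set V :=
  box (\row_j (ratr (q.1 0 j) - q.2.+1%:R^-1)) (\row_j (ratr (q.1 0 j) + q.2.+1%:R^-1)).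
pose F q : set mspace := if `[< B q `<=` U >] then B q else set0.
rewrite (_ : U = \bigcup_q F q).
  apply: countable_bigcupT_measurable => // q; rewrite /F.
  by case: ifPn => _; [exact: measurable_box|exact: measurable0].
apply/seteqP; split=> [x Ux|x [q _]]; rewrite /F; last by case: ifPn => // /asboolP; exact.
have /nbhs_ballP[e /= e0 xeU] : nbhs x U by exact: open_nbhs_nbhs.
(* Factor 2: one half-edge from [x] to the rational centre, another from the centre to any point of
   the box. *)
have [k k2] : exists k : nat, 2 * k.+1%:R^-1 < e.
  have [k _ /(_ k (leqnn k))] := near_infty_natSinv_lt (PosNum (divr_gt0 e0 (ltr0Sn R 1))).
  move=> h; exists k; rewrite mulrC -ltr_pdivlMr//; exact: h.
have k0 : 0 < k.+1%:R^-1 :> R by rewrite invr_gt0.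
have /choice[q xq] : forall j : 'I_n.+1, exists q : rat,
    x 0 j - k.+1%:R^-1 < ratr q < x 0 j + k.+1%:R^-1.
  move=> j; have [|q] := @rat_in_itvoo R (x 0 j - k.+1%:R^-1) (x 0 j + k.+1%:R^-1).
    by rewrite ltrBlDr -addrA ltrDl addr_gt0.
  by rewrite in_itv/= => ?; exists q.
exists (\row_j q j, k) => //; rewrite /F.
case: ifPn => [_ j|/asboolPn]; first by
  have /andP[] := xq j; rewrite !mxE/=; move: (k.+1%:R^-1) => t *; lra.
apply: contra_notP => _ y By; apply: xeU; split=> // i j; rewrite ord1.
have /andP[] := By j; have /andP[] := xq j; rewrite !mxE/= /ball/= ltr_norml.
by move: (k.+1%:R^-1) k0 k2 => t *; lra.
Qed.

Lemma continuous_measurable_rV (f : V -> R) (D : set mspace) :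
  continuous f -> measurable_fun D (f : mspace -> R).
Proof.
move=> cf; apply: measurable_funTS.
apply: (measurability _ (RGenOInfty.measurableE R)) => /= _ [_ [a ->] <-].
rewrite setTI; apply: measurable_open_rV.
by apply: open_comp => // x _; exact: cf.
Qed.

(** The library ball is one of the maximum norm, hence lies in a box of edge 2r; that box followed
    by empty sets is an admissible cover. *)
Lemma lebesgue_ball_le (x : V) (r : R) : 0 <= r ->
  (lebesgue_measure_rV R n (ball x r) <= ((2 * r) ^+ n.+1)%:E)%E.
Proof.
move=> r0; pose b := box (x - const_mx r) (x + const_mx r).
apply: (@le_trans _ _ (outer b)).
  apply: le_outer_measure => y [_ xy] j; have := xy 0 j.
  by rewrite /ball/= ltr_norml !mxE; lra.
apply: (@le_trans _ _ (box_cost b)).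
  apply: ereal_inf_lbound; exists (fun k : nat => if k is 0%N return set V then b else set0).
    by split=> // y yb; exists 0%N.
  rewrite nneseries_recl//; last by move=> *; exact: box_cost_ge0.
  by rewrite eseries_cond/= eseries0 ?adde0// => -[|]//= k _ _; exact: box_cost0.
apply: (le_trans (box_cost_le _ _)); rewrite lee_fin /box_volume.
rewrite (eq_bigr (fun=> 2 * r)) ?prodr_const ?card_ord// => j _.
rewrite !mxE /Num.max; case: ifPn => //; rewrite -?leNgt; lra.
Qed.

Lemma lebesgue_set1 (x : V) : lebesgue_measure_rV R n [set x] = 0%E.
Proof.
apply/eqP; rewrite eq_le measure_ge0 andbT; apply/lee_addgt0Pr => e e0.
rewrite add0e.
(* With this radius the bound (2r)^(n+1) is min(1,e)^(n+1): one factor is at most e, the other n are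
   at most 1. *)
pose r : R := Num.min 1 e / 2; have r0 : 0 < r by rewrite divr_gt0// lt_min e0 ltr01.
apply: (@le_trans _ _ (lebesgue_measure_rV R n (ball x r))).
  by apply: le_outer_measure => _ ->; exact: ballxx.
have := @lebesgue_ball_le x r (ltW r0); move=> /le_trans; apply.
rewrite lee_fin exprS (_ : 2 * r = Num.min 1 e); last by rewrite /r; lra.
have m0 : 0 <= Num.min 1 e by rewrite le_min ler01 ltW.
rewrite -[leRHS]mulr1 ler_pM ?exprn_ge0// ?exprn_ile1//.
  by rewrite ge_min lexx orbT.
by rewrite ge_min lexx.
Qed.

Lemma lebesgue_bounded_lty (A : set V) : bounded_set A ->
  (lebesgue_measure_rV R n A < +oo)%E.
Proof.
case=> M [_ AM]; pose r := `|M| + 1.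
have AB : A `<=` ball (0 : V) (r + 1).
  move=> x Ax; rewrite -ball_normE /ball_ /= sub0r normrN.
  apply: (@le_lt_trans _ _ r); last by rewrite ltrDl.
  by apply: (AM r) => //; rewrite /r (le_lt_trans (ler_norm M))// ltrDl.
apply: (le_lt_trans (le_outer_measure outer _ _ AB)).
have := @lebesgue_ball_le 0 (r + 1); move=> /(_ _)/le_lt_trans; apply; rewrite ?ltry//.
by rewrite /r addr_ge0// addr_ge0.
Qed.

End lebesgue_open.

(** * Euclidean norm and distance to the boundary *)

(** Evaluate at the minimizer -b/c; if c = 0, an affine function bounded below has slope 0. Both
    Cauchy-Schwarz inequalities below, for vectors and for [dot], come from here. *)
Lemma discriminant_le (R : realFieldType) (a b c : R) : 0 <= c ->
  (forall t, 0 <= a + 2 * b * t + c * t ^+ 2) -> b ^+ 2 <= a * c.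
Proof.
rewrite le0r => /orP[/eqP->|c0] abc.
  have [->|b0] := eqVneq b 0; first by rewrite expr0n mulr0.
  have := abc (- (a + 1) / (2 * b)); rewrite mul0r addr0.
  rewrite mulrC divfK ?mulf_neq0 ?pnatr_eq0//; lra.
have := abc (- b / c).
have -> : a + 2 * b * (- b / c) + c * (- b / c) ^+ 2 = (a * c - b ^+ 2) / c.
  by field; rewrite gt_eqF.
by rewrite pmulr_lge0 ?invr_gt0// subr_ge0.
Qed.

Section euclidean_norm.
Context (R : realType) (n : nat).
Implicit Types x y : 'rV[R]_n.

Lemma enorm_ge0 x : 0 <= enorm x. Proof. exact: sqrtr_ge0. Qed.

Lemma enormN x : enorm (- x) = enorm x.
Proof. by congr Num.sqrt; apply: eq_bigr => j _; rewrite mxE sqrrN. Qed.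

Lemma ler_enormD x y : enorm (x + y) <= enorm x + enorm y.
Proof.
have sum0 (z : 'rV[R]_n) : 0 <= \sum_j z 0 j ^+ 2 by apply: sumr_ge0 => j _; exact: sqr_ge0.
rewrite -(@ler_pXn2r _ 2) ?nnegrE ?addr_ge0 ?enorm_ge0//.
rewrite sqrrD /enorm !sqr_sqrtr ?sum0//.
set B := \sum_j x 0 j * y 0 j.
have -> : \sum_j (x + y) 0 j ^+ 2 = \sum_j x 0 j ^+ 2 + B *+ 2 + \sum_j y 0 j ^+ 2.
  rewrite -sumrMnl -!big_split/=; apply: eq_bigr => j _.
  by rewrite !mxE sqrrD.
rewrite lerD2r lerD2l lerMn2r/=; apply: (le_trans (ler_norm _)).
rewrite -(@ler_pXn2r _ 2) ?nnegrE ?mulr_ge0 ?enorm_ge0//.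
rewrite exprMn /enorm !sqr_sqrtr ?sum0// real_normK ?num_real//.
apply: discriminant_le => // t; rewrite (_ : _ + _ = \sum_j (x + t *: y) 0 j ^+ 2)//.
rewrite /B mulr_sumr !mulr_suml -!big_split/=; apply: eq_bigr => j _.
by rewrite !mxE; ring.
Qed.

Lemma enorm_subC x y : enorm (x - y) = enorm (y - x).
Proof. by rewrite -enormN opprB. Qed.

End euclidean_norm.

Lemma norm_le_enorm (R : realType) (n : nat) (x : 'rV[R]_n) : `|x| <= enorm x.
Proof.
rewrite /Num.norm/=.
have [->|/mx_norm_neq0[[i j] /= ->]] := eqVneq (mx_norm x) 0; first exact: enorm_ge0.
rewrite -sqrtr_sqr ler_wsqrtr// ord1 (bigD1 j)//= lerDl.
by apply: sumr_ge0 => k _; exact: sqr_ge0.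
Qed.

Lemma enorm_le_norm (R : realType) (n : nat) (x : 'rV[R]_n) : enorm x <= n%:R * `|x|.
Proof.
have xle j : `|x 0 j| <= `|x|.
  rewrite [leRHS]/Num.norm/= mx_normrE.
  exact: (le_bigmax _ (fun ij : 'I_1 * 'I_n => `|x ij.1 ij.2|) (0, j)).
rewrite -(@ler_pXn2r _ 2) ?nnegrE ?mulr_ge0 ?enorm_ge0//.
rewrite sqr_sqrtr; last by apply: sumr_ge0 => j _; exact: sqr_ge0.
apply: (@le_trans _ _ (\sum_(j < n) `|x| ^+ 2)).
  by apply: ler_sum => j _; rewrite -(real_normK (num_real (x 0 j))) lerXn2r ?nnegrE.
rewrite sumr_const card_ord exprMn -[leLHS]mulr_natl ler_wpM2r ?sqr_ge0//.
by rewrite -natrX ler_nat; case: (n) => // m; rewrite expnS leq_pmulr// expn_gt0.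
Qed.

Section boundary_distance.
Context (R : realType) (n : nat) (Om : set 'rV[R]_n).

Lemma bdist_ge0 x : 0 <= bdist Om x.
Proof.
(* For an empty boundary the infimum takes its default value 0. *)
rewrite /bdist; have [->|/set0P[z0 bz0]] := eqVneq (boundary Om) set0.
  by rewrite image_set0 inf0.
apply: lb_le_inf; first by exists (enorm (x - z0)), z0.
by move=> _ [z _ <-]; exact: enorm_ge0.
Qed.

Lemma bdist_le x y : bdist Om y <= bdist Om x + enorm (x - y).
Proof.
rewrite /bdist.
have [->|/set0P[z0 bz0]] := eqVneq (boundary Om) set0.
  by rewrite !image_set0 inf0 add0r enorm_ge0.
rewrite -lerBlDr; apply: lb_le_inf; first by exists (enorm (x - z0)), z0.
move=> _ [z bz <-]; rewrite lerBlDr.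
apply: (@le_trans _ _ (enorm (y - z))).
  apply: ge_inf; last by exists z.
  by exists 0 => _ [w _ <-]; exact: enorm_ge0.
have -> : y - z = (x - z) + (y - x) by rewrite [RHS]addrC addrA subrK.
by rewrite (enorm_subC x y) ler_enormD.
Qed.

End boundary_distance.

Lemma continuous_bdist (R : realType) (n : nat) (Om : set 'rV[R]_n.+1) :
  continuous (bdist Om).
Proof.
move=> x; apply/(@cvgrPdist_le _ _ _ (nbhs x) (nbhs_filter x)) => e e0.
apply: (@filterS _ (nbhs x) (nbhs_filter x)) (nbhsx_ballx x (e / n.+1%:R) _).
  2: by rewrite divr_gt0.
move=> y; rewrite -ball_normE /= ltr_pdivlMr// mulrC => xy.
have {}xy := le_lt_trans (enorm_le_norm _) xy.
rewrite ler_norml.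
have := bdist_le Om x y; have := bdist_le Om y x; rewrite (enorm_subC y x); lra.
Qed.

Lemma measurable_bdist_powR (R : realType) (n : nat) (Om : set 'rV[R]_n.+1)
  (gam : R) (D : set (lebesgue_mspace R n)) :
  measurable_fun D ((fun x => bdist Om x `^ gam) : lebesgue_mspace R n -> R).
Proof.
apply: (measurableT_comp (@measurable_powR R gam)).
by apply: continuous_measurable_rV; exact: continuous_bdist.
Qed.

(** * Integral bound for the Green kernel *)

Section kernel.
Context (R : realType) (n : nat) (Om : set 'rV[R]_n.+1).
Local Notation V := 'rV[R]_n.+1.
Local Notation mu := (lebesgue_measure_rV R n).
Local Notation dim := (n.+1%:R : R).

(** If t <= delta(x), the right side is at least 1. Otherwise delta(y) <= delta(x) + t <= 2t, which
    trades delta(y)^gam for a power of t. This extracts delta(x)^gam at the price of one extra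
    singular factor t^(-gam). *)
Lemma min_bdist_le (gam t : R) (x y : V) : 0 < gam -> 0 < t -> enorm (x - y) = t ->
  Num.min (bdist Om x `^ gam * bdist Om y `^ gam / t `^ (2 * gam)) 1
    <= 2 `^ gam * bdist Om x `^ gam * t `^ (- gam).
Proof.
move=> g0 t0 xyt; have tg0 : 0 < t `^ gam by rewrite powR_gt0.
rewrite powRN ler_pdivlMr//.
have dx0 := bdist_ge0 Om x; have dy0 := bdist_ge0 Om y.
have [tx|xt] := leP t (bdist Om x).
  apply: (@le_trans _ _ (1 * t `^ gam)).
    by rewrite ler_wpM2r ?powR_ge0// ge_min lexx orbT.
  apply: ler_pM; rewrite ?powR_ge0//.
    by rewrite -[leLHS](powRr0 2) ler_powR ?ler1n ?(ltW g0).
  by apply: ge0_ler_powR; rewrite ?nnegrE ?(ltW g0) ?(ltW t0).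
apply: (@le_trans _ _ (bdist Om x `^ gam * (2 * t) `^ gam / t `^ (2 * gam) * t `^ gam)).
  rewrite ler_wpM2r ?powR_ge0// ge_min ler_wpM2r ?invr_ge0 ?powR_ge0//.
  rewrite ler_wpM2l ?powR_ge0// ge0_ler_powR ?nnegrE ?(ltW g0) ?mulr_ge0 ?(ltW t0)//.
  by have := bdist_le Om x y; rewrite xyt; lra.
rewrite powRM ?(ltW t0)// (mulr_natl gam) mulr2n powRD; last by rewrite (gt_eqF t0) implybT.
by rewrite le_eqVlt; apply/orP; left; apply/eqP; field; rewrite gt_eqF.
Qed.

Lemma geometric_nneseries_lty (a q : R) : 0 <= a -> 0 <= q < 1 ->
  (\sum_(0 <= k <oo) (a * q ^+ k)%:E < +oo)%E.
Proof.
move=> a0 /andP[q0 q1]; apply: (@le_lt_trans _ _ (a / (1 - q))%:E); last by rewrite ltry.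
apply: lime_le.
  by apply: is_cvg_nneseries => k _ _; rewrite lee_fin mulr_ge0// exprn_ge0.
near=> N; rewrite sumEFin lee_fin.
have := geometric_seriesE a (negbT (lt_eqF q1)) => /(congr1 (fun f => f N)).
rewrite /series/geometric/= => ->.
rewrite ler_wpM2r ?invr_ge0 ?subr_ge0 ?(ltW q1)// ler_piMr// gerBl.
exact: exprn_ge0.
Unshelve. all: by end_near. Qed.

(* Dyadic shells: |x - y|^-p is at most the value (r0 2^-k / 2)^-p on the
   ball of radius r0 2^-k that contains the k-th shell. *)
Lemma shell_series_bound (p r0 : R) : 0 <= p -> p < dim -> 0 < r0 ->
  exists2 C : R, 0 <= C & forall x : V, exists S : lebesgue_mspace R n -> \bar R,
    [/\ measurable_fun setT S,
        (forall y, 0 <= S y)%E,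
        (forall D, measurable (D : set (lebesgue_mspace R n)) ->
          (\int[mu]_(y in D) S y <= C%:E)%E) &
        forall y, y <> x -> `|x - y| < r0 -> ((enorm (x - y) `^ (- p))%:E <= S y)%E].
Proof.
move=> p0 pd r00; pose rho k : R := r0 * 2^-1 ^+ k.
have rho0 k : 0 < rho k by rewrite mulr_gt0// exprn_gt0.
pose c k := (rho k / 2) `^ (- p).
have c0 k : 0 <= c k by rewrite powR_ge0.
pose q : R := 2^-1 `^ (dim - p).
have q01 : 0 <= q < 1.
  rewrite powR_ge0/= /q -[ltRHS](_ : 1 `^ (dim - p) = 1); last by rewrite powR1.
  by apply: gt0_ltr_powR; rewrite ?subr_gt0 ?nnegrE ?invr_ge0// invf_lt1// ltr1n.
(* [a * q ^+ k] is the value on shell k times the volume bound of its ball; the ratio 2^-(dim - p)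
   is below 1 because p < dim. *)
pose a : R := 2 `^ p * 2 ^+ n.+1 * r0 `^ (dim - p).
have a0 : 0 <= a by rewrite !mulr_ge0 ?powR_ge0 ?exprn_ge0.
have cE k : c k * (2 * rho k) ^+ n.+1 = a * q ^+ k.
  have rk0 := rho0 k.
  rewrite /c powRM ?invr_ge0 ?(ltW rk0)//.
  rewrite -[X in _ * X `^ _ * _](powR_inv1 (ler0n _ 2)) -powRrM mulN1r opprK.
  rewrite exprMn -[rho k ^+ n.+1]powR_mulrn ?(ltW rk0)//.
  have -> : q ^+ k = (2^-1 ^+ k) `^ (dim - p).
    by rewrite -powR_mulrn ?powR_ge0// /q -powRrM (mulrC (dim - p)) powRrM powR_mulrn// invr_ge0.
  transitivity (2 `^ p * 2 ^+ n.+1 * (rho k `^ (- p) * rho k `^ dim)); first by ring.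
  rewrite -powRD; last by rewrite (gt_eqF rk0) implybT.
  rewrite addrC /rho powRM ?exprn_ge0 ?(ltW r00)// /a; ring.
have aoo := geometric_nneseries_lty a0 q01.
have s0 : (0 <= \sum_(0 <= k <oo) (a * q ^+ k)%:E)%E.
  by apply: nneseries_ge0 => k _ _; rewrite lee_fin mulr_ge0// exprn_ge0//; case/andP: q01.
exists (fine (\sum_(0 <= k <oo) (a * q ^+ k)%:E)%E); first exact: fine_ge0.
move=> x; pose B k : set (lebesgue_mspace R n) := ball x (rho k).
have mB k : measurable (B k) by apply: measurable_open_rV; exact: ball_open.
pose f k (y : lebesgue_mspace R n) : \bar R := ((c k)%:E * (\1_(B k) y)%:E)%E.
have f0 k y : (0 <= f k y)%E by rewrite /f mule_ge0// lee_fin.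
have m1 k D : measurable_fun D (fun y : lebesgue_mspace R n => (\1_(B k) y : R)%:E).
  by apply/measurable_EFinP; exact: measurable_indic.
have mf k D : measurable_fun D (f k).
  exact: emeasurable_funM (measurable_cst _) (m1 k D).
exists (fun y => \sum_(0 <= k <oo) f k y)%E; split.
- by apply: ge0_emeasurable_sum.
- by move=> y; exact: nneseries_ge0.
- move=> D mD; rewrite integral_nneseries// fineK ?ge0_fin_numE//.
  apply: lee_nneseries => [k _ _|k _]; first exact: integral_ge0.
  rewrite ge0_integralZl_EFin// integral_indic// -cE EFinM.
  apply: lee_wpmul2l; rewrite ?lee_fin//.
  apply: (@le_trans _ _ (mu (B k))); last by apply: lebesgue_ball_le; exact: ltW.
  by apply: le_measure; rewrite ?inE//; exact: measurableI.
- move=> y yx xyr; set t := `|x - y|.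
  have t0 : 0 < t by rewrite normr_gt0 subr_eq0; apply/eqP => /esym.
  have [k kP] : exists k, rho k.+1 <= t.
    have [k _ /(_ k (leqnn k)) /= kt] : \forall k \near \oo, 2^-1 ^+ k < t / r0.
      have h : (fun k => 2^-1 ^+ k : R) @ \oo --> (0 : R).
        by apply: cvg_expr; rewrite ger0_norm// invf_lt1// ltr1n.
      move/cvgrPdist_lt: h => /(_ _ (divr_gt0 t0 r00)); apply: filterS => k.
      by rewrite sub0r normrN ger0_norm// exprn_ge0// invr_ge0.
    exists k; apply: ltW; rewrite /rho mulrC -ltr_pdivlMr//.
    by apply: le_lt_trans kt; rewrite exprS ler_piMl ?exprn_ge0// invf_le1// ler1n.
  have exk : exists k, rho k.+1 <= t by exists k.
  (* The least such index is the shell of [y]: minimality, or [t < r0] when m = 0, puts [y] in the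
     ball of radius [rho m], while [rho m.+1 <= t] bounds the kernel. *)
  case: (ex_minnP exk) => m mt mmin.
  have mB' : B m y.
    rewrite /B -ball_normE /=; case: m mt mmin {exk} => [_ _|m _ mmin].
      by rewrite /rho expr0 mulr1.
    by rewrite ltNge; apply/negP => /mmin; rewrite ltnn.
  have ct : enorm (x - y) `^ (- p) <= c m.
    rewrite /c !powRN lef_pV2 ?posrE ?powR_gt0 ?divr_gt0//; last first.
      by apply: lt_le_trans t0 _; exact: norm_le_enorm.
    apply: ge0_ler_powR; rewrite ?nnegrE ?divr_ge0 ?enorm_ge0 ?(ltW (rho0 _))//.
    apply: le_trans (norm_le_enorm _); apply: le_trans mt.
    by rewrite /rho exprSr mulrA.
  apply: (@le_trans _ _ (f m y)).
    by rewrite /f indicE mem_set// mule1 lee_fin.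
  by rewrite (nneseriesD1 (n := m))// leeDl// nneseries_ge0.
Qed.

(** By (K1) and [min_bdist_le] the kernel is at most a constant times delta(x)^gam |x-y|^-p with p =
    dim - 2s + gam. The hypothesis gam < 2s says exactly p < dim, so the singularity is integrable
    uniformly in x. *)
Lemma green_integral_le (s gam : R) (G : V -> V -> R) :
  bounded_set Om -> open Om ->
  (forall x, Om x -> measurable_fun (Om : set (lebesgue_mspace R n))
        (G x : lebesgue_mspace R n -> R)) ->
  0 < gam -> gam < 2 * s -> 2 * s < dim -> K1 Om s gam G ->
  exists2 C : R, 0 <= C & forall x, Om x ->
    (\int[mu]_(y in Om) `|(G x y)%:E| <= (C * bdist Om x `^ gam)%:E)%E.
Proof.
move=> [M [_ OmM]] oOm mG g0 gs sdim [_ Gpos _ [C C0 GC]].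
have OmM' x : Om x -> `|x| <= `|M| + 1.
  by move=> Ox; apply: (OmM (`|M| + 1)) => //; rewrite (le_lt_trans (ler_norm M))// ltrDl.
(* Exceeds the maximum-norm diameter of [Om], so the shells around any [x] in [Om] exhaust it. *)
pose r0 := 2 * (`|M| + 1) + 1.
have Omr x y : Om x -> Om y -> `|x - y| < r0.
  move=> /OmM' Ox /OmM' Oy; apply: (le_lt_trans (ler_normB _ _)).
  rewrite /r0; lra.
pose p := dim - 2 * s + gam.
have r00 : 0 < r0 by rewrite /r0 ltr_wpDl// mulr_ge0// addr_ge0.
have [||K K0 KS] := @shell_series_bound p r0 _ _ r00; [rewrite /p; lra..|].
exists (C * 2 `^ gam * K); first by rewrite !mulr_ge0 ?powR_ge0// ltW.
move=> x Ox; have [S [mS S0 SK Sle]] := KS x.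
have mOm : measurable (Om : set (lebesgue_mspace R n)) by exact: measurable_open_rV.
set dx := bdist Om x `^ gam.
have A0 : 0 <= C * 2 `^ gam * dx by rewrite !mulr_ge0 ?powR_ge0// ltW.
have mSOm : measurable_fun (Om : set (lebesgue_mspace R n)) S by exact: measurable_funTS.
apply: (@le_trans _ _ (\int[mu]_(y in Om) ((C * 2 `^ gam * dx)%:E * S y))%E); last first.
  rewrite ge0_integralZl_EFin// (mulrAC _ K) [leRHS]EFinM.
  by apply: lee_wpmul2l; rewrite ?lee_fin//; exact: SK.
apply: ae_ge0_le_integral.
- exact: mOm.
- by move=> y _; exact: abse_ge0.
- apply: measurableT_comp; first exact: abse_measurable.
  by apply/measurable_EFinP; exact: mG.
- by move=> y _; rewrite mule_ge0// lee_fin.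
- exact: emeasurable_funM (measurable_cst _) mSOm.
(* (K1) is silent on the diagonal, so the pointwise bound is claimed only off the null set {x}. *)
exists [set x : lebesgue_mspace R n]; split.
- rewrite (_ : [set x] = ~` (~` [set x]) :> set V); last by rewrite setCK.
  apply: measurableC; apply: measurable_open_rV; rewrite openC.
  exact: (@accessible_closed_set1 V (hausdorff_accessible (@norm_hausdorff _ V))).
- exact: lebesgue_set1.
move=> y /= /not_implyP[Oy]; apply: contra_notP => /eqP yx.
have xy : off_diagonal Om (x, y) by split => //= /esym/eqP; rewrite (negbTE yx).
have nxy : 0 < enorm (x - y).
  by rewrite (lt_le_trans _ (norm_le_enorm _))// normr_gt0 subr_eq0 eq_sym.
apply: (@le_trans _ _ ((C * 2 `^ gam * dx)%:E * (enorm (x - y) `^ (- p))%:E)%E); last first.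
  by apply: lee_wpmul2l; rewrite ?lee_fin//; apply: Sle; [exact/eqP|exact: Omr].
suff h : G x y <= C * 2 `^ gam * dx * enorm (x - y) `^ (- p).
  by move: (Gpos _ _ xy) => /gtr0_norm /= ->; rewrite lee_fin.
have /andP[_ /le_trans] := GC x y xy; apply.
have -> : enorm (x - y) `^ (- p) =
    enorm (x - y) `^ (- (dim - 2 * s)) * enorm (x - y) `^ (- gam).
  by rewrite -powRD ?(gt_eqF nxy) ?implybT// /p opprD.
have := min_bdist_le g0 nxy erefl; rewrite -/dx.
move: (Num.min _ _) (powR_ge0 (enorm (x - y)) (- (dim - 2 * s))) => m.
move: (_ `^ (- (_ - _))) (_ `^ (- gam)) (2 `^ gam) => a b c a0 mle.
rewrite [leRHS](_ : _ = C * (a * (c * dx * b))); last by ring.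
by rewrite ler_wpM2l ?(ltW C0)// ler_wpM2l.
Qed.

End kernel.

(** * Dictionary between L^p classes of functions extended by zero and integrals over D *)

Section restricted_Lfun.
Context d (T : measurableType d) (R : realType) (mu : {measure set T -> \bar R}).
Context (D : set T) (mD : measurable D).
Implicit Types f g : T -> R.

Lemma ae_le_integrable f g : measurable_fun D f -> mu.-integrable D (EFin \o g) ->
  {ae mu, forall x, D x -> `|f x| <= g x} -> mu.-integrable D (EFin \o f).
Proof.
move=> mf /integrableP[mg goo] fg; apply/integrableP; split; first exact/measurable_EFinP.
apply: le_lt_trans goo; apply: ae_ge0_le_integral => //.
- by apply: measurableT_comp => //; exact/measurable_EFinP.
- by apply: measurableT_comp.
- by apply: filterS fg => x /[apply] /= fg; rewrite lee_fin (le_trans fg)// ler_norm.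
Qed.

Lemma integrable_EFinD f g : mu.-integrable D (EFin \o f) -> mu.-integrable D (EFin \o g) ->
  mu.-integrable D (EFin \o (fun x => f x + g x)).
Proof. by move=> fi gi; exact: integrableD fi gi. Qed.

Lemma integrable_EFinZ a f : mu.-integrable D (EFin \o f) ->
  mu.-integrable D (EFin \o (fun x => a * f x)).
Proof. by move=> fi; exact: integrableZl fi. Qed.

Lemma ae_eq_Rintegral f g : mu.-integrable D (EFin \o f) -> mu.-integrable D (EFin \o g) ->
  {ae mu, forall x, D x -> f x = g x} ->
  (\int[mu]_(x in D) f x = \int[mu]_(x in D) g x)%R.
Proof.
move=> fi gi fg; congr fine; apply: ae_eq_integral => //.
- exact: measurable_int fi.
- exact: measurable_int gi.
- by apply: filterS fg => x /[apply] ->.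
Qed.

(** Replace [g] by max(f, g): it dominates [f] everywhere and equals [g] almost everywhere, so
    pointwise monotonicity and invariance under a.e. equality suffice. *)
Lemma ae_le_Rintegral f g : mu.-integrable D (EFin \o f) -> mu.-integrable D (EFin \o g) ->
  {ae mu, forall x, D x -> f x <= g x} ->
  (\int[mu]_(x in D) f x <= \int[mu]_(x in D) g x)%R.
Proof.
move=> fi gi fg.
have mi : mu.-integrable D (EFin \o (fun x => Num.max (f x) (g x))).
  apply: (@ae_le_integrable _ (fun x => `|f x| + `|g x|)).
  - apply: measurable_maxr; apply/measurable_EFinP.
      exact: measurable_int fi.
    exact: measurable_int gi.
  - apply: integrable_EFinD; first exact: integrable_abse fi.
    exact: integrable_abse gi.
  - apply: nearW => x _; rewrite /Num.max; case: ifPn => _.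
      by rewrite lerDr.
    by rewrite lerDl.
apply: (@le_trans _ _ (\int[mu]_(x in D) Num.max (f x) (g x))%R).
  by apply: le_Rintegral => // x _; rewrite le_max lexx.
rewrite le_eqVlt; apply/orP; left; apply/eqP; apply: ae_eq_Rintegral => //.
by apply: filterS fg => x /[apply] fg; exact/max_idPr.
Qed.

Lemma Rintegral_normr_eq0 f : mu.-integrable D (EFin \o f) ->
  (\int[mu]_(x in D) `|f x| = 0)%R -> {ae mu, forall x, D x -> f x = 0}.
Proof.
move=> fi f0; have mf := measurable_int _ fi.
have : (\int[mu]_(x in D) `|(EFin \o f) x| = 0)%E.
  rewrite -[LHS]fineK; first by rewrite -[RHS]/(0%:E) -f0.
  by apply: integrable_fin_num => //; exact: integrable_abse.
move=> /(ae_eq_integral_abs mu mD mf); apply: filterS => x /[apply].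
by case.
Qed.

Lemma measurable_patch f : measurable_fun D f <-> f \_ D \in mfun.
Proof.
rewrite inE /=; exact: (measurable_restrictT f mD).
Qed.

Lemma Lfun1_patch f : f \_ D \in Lfun mu 1 <-> mu.-integrable D (EFin \o f).
Proof. by rewrite Lfun1_integrable -restrict_EFin; symmetry; exact: integrable_mkcond. Qed.

Lemma Lnorm1_patch f : Lnorm mu 1 (EFin \o f \_ D) = (\int[mu]_(x in D) `|(f x)%:E|)%E.
Proof.
rewrite Lnorm1 [RHS]integral_mkcond; apply: eq_integral => x _.
by rewrite /= !patchE; case: ifPn => //; rewrite normr0.
Qed.

Let sqr_patch f x : (`|(f \_ D) x| `^ 2)%R%:E = ((EFin \o (fun x => f x ^+ 2)) \_ D) x.
Proof.
rewrite powR_mulrn// real_normK ?num_real//= !patchE.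
by case: ifPn => // _; rewrite expr0n.
Qed.

Let integral_sqr_patch f :
  (\int[mu]_x (`|(EFin \o f \_ D) x| `^ 2) = \int[mu]_(x in D) (f x ^+ 2)%:E)%E.
Proof.
by rewrite [RHS]integral_mkcond; apply: eq_integral => x _; rewrite -sqr_patch.
Qed.

Lemma Lfun2_patch f : f \_ D \in Lfun mu 2%:E <->
  measurable_fun D f /\ mu.-integrable D (EFin \o (fun x => f x ^+ 2)).
Proof.
split=> [fL|[mf fi]].
  split; first by apply/measurable_patch; move: fL; rewrite inE => /andP[].
  apply/integrable_mkcond => //.
  have := Lfun2_integrable_sqr fL; congr (_.-integrable _ _).
  by apply/funext => x; rewrite -sqr_patch /= powR_mulrn// real_normK ?num_real.
rewrite inE; apply/andP; split; first exact/measurable_patch.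
rewrite inE /= /finite_norm unlock integral_sqr_patch poweR_lty//.
exact: integrable_lty fi.
Qed.

Lemma Lnorm2_patch f : mu.-integrable D (EFin \o (fun x => f x ^+ 2)) ->
  Lnorm mu 2%:E (EFin \o f \_ D) = (Num.sqrt (\int[mu]_(x in D) (f x * f x))%R)%:E.
Proof.
move=> fi; rewrite unlock integral_sqr_patch.
rewrite -[X in (X `^ _)%E]fineK; last exact: integrable_fin_num fi.
rewrite poweR_EFin powR12_sqrt; last first.
  by apply: fine_ge0; apply: integral_ge0 => x _; rewrite lee_fin sqr_ge0.
by congr (Num.sqrt _)%:E; apply: eq_Rintegral => x _; rewrite expr2.
Qed.

Lemma Lnormy_patch_le f (M : R) : 0 <= M ->
  (Lnorm mu +oo%E (EFin \o f \_ D) <= M%:E)%E <-> {ae mu, forall x, D x -> `|f x| <= M}.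
Proof.
move=> M0; have aeE : {ae mu, forall x, (abse \o (EFin \o f \_ D)) x <= M%:E}%E <->
    {ae mu, forall x, D x -> `|f x| <= M}.
  split; apply: filterS => x /=; rewrite patchE lee_fin.
    by move=> + Dx; rewrite mem_set.
  by case: ifPn => [/set_mem Dx /(_ Dx)//|_ _]; rewrite normr0.
rewrite unlock; case: ifPn => [muT|].
  by rewrite -aeE; split => /ess_supP.
(* When the whole space is null, the norm is 0 by convention and every a.e. statement holds. *)
rewrite lt0e measure_ge0 andbT negbK => /eqP muT; split => [_|]; last by rewrite lee_fin.
by exists setT; split.
Qed.

Lemma Lfuny_patch f : f \_ D \in Lfun mu +oo%E <->
  measurable_fun D f /\ exists2 M, 0 <= M & {ae mu, forall x, D x -> `|f x| <= M}.
Proof.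
split=> [|[mf [M M0 fM]]].
  rewrite inE => /andP[mf]; rewrite inE /= /finite_norm => foo; split; first exact/measurable_patch.
  exists (fine (Lnorm mu +oo%E (EFin \o f \_ D))); first exact/fine_ge0/Lnorm_ge0.
  by apply/Lnormy_patch_le; rewrite ?fineK ?ge0_fin_numE ?Lnorm_ge0//; exact/fine_ge0/Lnorm_ge0.
rewrite inE; apply/andP; split; first exact/measurable_patch.
by rewrite inE/= /finite_norm (le_lt_trans ((Lnormy_patch_le _ M0).2 fM))// ltry.
Qed.

End restricted_Lfun.

(** * L^1, L^2 and L^oo on a set of finite measure, and the L^2 pairing *)

Section finite_measure_Lp.
Context d (T : measurableType d) (R : realType) (mu : {measure set T -> \bar R}).
Context (D : set T) (mD : measurable D) (muD : (mu D < +oo)%E).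
Implicit Types f g h : T -> R.

Local Notation L1 f := (f \_ D \in Lfun mu 1).
Local Notation L2 f := (f \_ D \in Lfun mu 2%:E).
Local Notation Loo f := (f \_ D \in Lfun mu +oo%E).
Local Notation dot f g := (\int[mu]_(x in D) (f x * g x))%R.

Lemma integrable_cst_fin c : mu.-integrable D (EFin \o cst c).
Proof.
apply/integrableP; split; first by apply/measurable_EFinP; exact: measurable_cst.
under eq_integral do rewrite /=.
rewrite integral_cst//=; rewrite lte_mul_pinfty//.
Qed.

Lemma Lfun2_measurable f : L2 f -> measurable_fun D f.
Proof. by move=> /(Lfun2_patch _ mD)[]. Qed.

Lemma Lfun2_mul_integrable f g : L2 f -> L2 g ->
  mu.-integrable D (EFin \o (fun x => f x * g x)).
Proof.
move=> /(Lfun2_patch _ mD)[mf fi] /(Lfun2_patch _ mD)[mg gi].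
apply: (ae_le_integrable mD _ (integrable_EFinD mD fi gi)).
  exact: measurable_funM.
apply: nearW => x _; rewrite normrM.
have := sqr_ge0 (`|f x| - `|g x|); rewrite sqrrB !real_normK ?num_real// mulr2n.
have := mulr_ge0 (normr_ge0 (f x)) (normr_ge0 (g x)); lra.
Qed.

Lemma Lfun2_lin a b f g : L2 f -> L2 g -> L2 (fun x => a * f x + b * g x).
Proof.
move=> f2 g2; have fg := Lfun2_mul_integrable f2 g2.
move: f2 g2 => /(Lfun2_patch _ mD)[mf fi] /(Lfun2_patch _ mD)[mg gi].
apply/Lfun2_patch => //; split.
  by apply: measurable_funD; apply: measurable_funM.
rewrite (_ : (fun x => _) = (fun x => (a ^+ 2 * f x ^+ 2 + (2 * a * b) * (f x * g x)) + b ^+ 2 * g x ^+ 2)).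
  by apply: integrable_EFinD => //; [apply: integrable_EFinD => //|]; exact: integrable_EFinZ.
by apply/funext => x; ring.
Qed.

Lemma Lfun2_0 : L2 (cst 0 : T -> R).
Proof.
apply/Lfun2_patch => //; split=> //.
rewrite (_ : (fun x => _) = cst 0); first exact: integrable_cst_fin.
by apply/funext => x; rewrite /= expr0n.
Qed.

Lemma Lfun2_scale a f : L2 f -> L2 (fun x => a * f x).
Proof.
move=> f2; have -> : (fun x => a * f x) = (fun x => a * f x + 0 * f x).
  by apply/funext => x; ring.
exact: Lfun2_lin.
Qed.

Lemma Lfun2_add f g : L2 f -> L2 g -> L2 (fun x => f x + g x).
Proof.
move=> f2 g2; have -> : (fun x => f x + g x) = (fun x => 1 * f x + 1 * g x).
  by apply/funext => x; ring.
exact: Lfun2_lin.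
Qed.

Lemma Lfun2_sub f g : L2 f -> L2 g -> L2 (f \- g).
Proof.
move=> f2 g2; have -> : f \- g = (fun x => 1 * f x + (-1) * g x).
  by apply/funext => x /=; ring.
exact: Lfun2_lin.
Qed.

Lemma Lfun2_sum N (f : nat -> T -> R) : (forall j, L2 (f j)) ->
  L2 (fun x => \sum_(j < N) f j x).
Proof.
move=> f2; elim: N => [|N IH].
  have -> : (fun x => \sum_(j < 0) f j x) = cst 0 by apply/funext => x; rewrite big_ord0.
  exact: Lfun2_0.
have -> : (fun x => \sum_(j < N.+1) f j x) = (fun x => \sum_(j < N) f j x + f N x).
  by apply/funext => x; rewrite big_ord_recr.
exact: Lfun2_add.
Qed.

Lemma Lfuny_Lfun2 f : Loo f -> L2 f.
Proof.
move=> /(Lfuny_patch _ mD)[mf [M M0 fM]]; apply/Lfun2_patch => //; split => //.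
apply: (ae_le_integrable mD _ (integrable_cst_fin (M ^+ 2))).
  exact: measurable_funX.
apply: filterS fM => x /[apply] fM.
by rewrite normrX lerXn2r ?nnegrE.
Qed.

Lemma Lfun2_Lfun1 f : L2 f -> L1 f.
Proof.
move=> /(Lfun2_patch _ mD)[mf fi]; apply/Lfun1_patch => //.
apply: (ae_le_integrable mD mf (integrable_EFinD mD fi (integrable_cst_fin 1))).
apply: nearW => x _ /=; rewrite ler_norml; have := sqr_ge0 (f x - 1); have := sqr_ge0 (f x + 1).
rewrite sqrrD sqrrB !expr1n !mulr1 mulr2n; have := sqr_ge0 (f x); lra.
Qed.

Lemma Lfun1_mul_Lfuny_integrable f g : L1 f -> Loo g ->
  mu.-integrable D (EFin \o (fun x => f x * g x)).
Proof.
move=> /(Lfun1_patch _ mD) fi /(Lfuny_patch _ mD)[mg [M M0 gM]].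
have mf : measurable_fun D f by apply/measurable_EFinP; exact: measurable_int fi.
have afi : mu.-integrable D (EFin \o (fun x => `|f x|)) by exact: (integrable_abse fi).
apply: (ae_le_integrable mD _ (integrable_EFinZ mD M afi)).
  exact: measurable_funM.
apply: filterS gM => x /[apply] gM.
by rewrite normrM mulrC ler_wpM2r.
Qed.

Lemma integrable_EFinB f g : mu.-integrable D (EFin \o f) -> mu.-integrable D (EFin \o g) ->
  mu.-integrable D (EFin \o (fun x => f x - g x)).
Proof. by move=> fi gi; exact: (integrableB mD fi gi). Qed.

Lemma Lfun1_sub f g : L1 f -> L1 g -> L1 (f \- g).
Proof.
move=> /(Lfun1_patch _ mD) fi /(Lfun1_patch _ mD) gi; apply/Lfun1_patch => //.
exact: integrable_EFinB.
Qed.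

Lemma Lfun1_lin a b f g : L1 f -> L1 g -> L1 (fun x => a * f x + b * g x).
Proof.
move=> /(Lfun1_patch _ mD) fi /(Lfun1_patch _ mD) gi; apply/Lfun1_patch => //.
by apply: integrable_EFinD => //; exact: integrable_EFinZ.
Qed.

Lemma dotC f g : dot f g = dot g f.
Proof. by apply: eq_Rintegral => x _; rewrite mulrC. Qed.

Lemma dot_lin a b f g h : mu.-integrable D (EFin \o (fun x => f x * h x)) ->
  mu.-integrable D (EFin \o (fun x => g x * h x)) ->
  (\int[mu]_(x in D) ((a * f x + b * g x) * h x) = a * dot f h + b * dot g h)%R.
Proof.
move=> fh gh; rewrite -!RintegralZl// -RintegralD//; [|exact: integrable_EFinZ..].
by apply: eq_Rintegral => x _; ring.
Qed.

Lemma dot_sub f g h : mu.-integrable D (EFin \o (fun x => f x * h x)) ->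
  mu.-integrable D (EFin \o (fun x => g x * h x)) ->
  (\int[mu]_(x in D) ((f x - g x) * h x) = dot f h - dot g h)%R.
Proof.
move=> fh gh; rewrite -RintegralB//.
by apply: eq_Rintegral => x _; ring.
Qed.

Lemma dot_scale a f h : mu.-integrable D (EFin \o (fun x => f x * h x)) ->
  (\int[mu]_(x in D) ((a * f x) * h x) = a * dot f h)%R.
Proof.
by move=> fh; rewrite -RintegralZl//; apply: eq_Rintegral => x _; ring.
Qed.

Lemma dot_sum N (f : nat -> T -> R) h : (forall j, L2 (f j)) -> L2 h ->
  (\int[mu]_(x in D) ((\sum_(j < N) f j x) * h x) = \sum_(j < N) dot (f j) h)%R.
Proof.
move=> f2 h2; elim: N => [|N IH].
  rewrite big_ord0; under eq_Rintegral do rewrite big_ord0 mul0r.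
  by rewrite Rintegral_cst// mul0r.
rewrite big_ord_recr/= -IH -RintegralD//.
- by apply: eq_Rintegral => x _; rewrite big_ord_recr/= mulrDl.
- by apply: Lfun2_mul_integrable => //; exact: Lfun2_sum.
- exact: Lfun2_mul_integrable.
Qed.

Lemma dot_ge0 f : 0 <= dot f f.
Proof. by apply: Rintegral_ge0 => x _; rewrite -expr2 sqr_ge0. Qed.

(** The quadratic t -> <f + t g, f + t g> is nonnegative, so [discriminant_le] applies. *)
Lemma dot_CS f g : L2 f -> L2 g -> (dot f g) ^+ 2 <= dot f f * dot g g.
Proof.
move=> f2 g2; apply: discriminant_le; first exact: dot_ge0.
move=> t; pose F x := 1 * f x + t * g x.
have E h : L2 h -> dot F h = 1 * dot f h + t * dot g h.
  by move=> h2; rewrite dot_lin//; exact: Lfun2_mul_integrable.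
have F2 : L2 F by exact: Lfun2_lin.
have := dot_ge0 F; rewrite E// (dotC f F) (dotC g F) !E// (dotC g f).
by congr (_ <= _); ring.
Qed.

Lemma dot_normr_le f g : L2 f -> L2 g ->
  `|dot f g| <= Num.sqrt (dot f f) * Num.sqrt (dot g g).
Proof.
move=> f2 g2; rewrite -sqrtrM ?dot_ge0// -sqrtr_sqr ler_wsqrtr//.
exact: dot_CS.
Qed.

Lemma dot_eq0 f : L2 f -> dot f f = 0 -> {ae mu, forall x, D x -> f x = 0}.
Proof.
move=> f2 f0.
have : {ae mu, forall x, D x -> f x * f x = 0}.
  apply: Rintegral_normr_eq0 => //; first exact: Lfun2_mul_integrable.
  by rewrite -[RHS]f0; apply: eq_Rintegral => x _; rewrite ger0_norm// -expr2 sqr_ge0.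
by apply: filterS => x /[apply] /eqP; rewrite mulf_eq0 orbb => /eqP.
Qed.

Lemma dot_ae_eql f g h : L2 f -> L2 g -> L2 h ->
  {ae mu, forall x, D x -> f x = g x} -> dot f h = dot g h.
Proof.
move=> f2 g2 h2 fg; apply: ae_eq_Rintegral => //; [exact: Lfun2_mul_integrable..|].
by apply: filterS fg => x /[apply] ->.
Qed.

Lemma dot_le_L1_Loo f g M : L1 f -> measurable_fun D g -> 0 <= M ->
  {ae mu, forall x, D x -> `|g x| <= M} ->
  `|dot f g| <= M * (\int[mu]_(x in D) `|f x|)%R.
Proof.
move=> f1 mg M0 gM; have goo : Loo g by apply/Lfuny_patch => //; split=> //; exists M.
have fg := Lfun1_mul_Lfuny_integrable f1 goo.
apply: (le_trans (le_normr_Rintegral mD fg)).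
have /(Lfun1_patch _ mD) fi := f1.
have afi : mu.-integrable D (EFin \o (fun x => `|f x|)) by exact: (integrable_abse fi).
rewrite -RintegralZl//; apply: ae_le_Rintegral => //.
- exact: (integrable_abse fg).
- exact: integrable_EFinZ.
by apply: filterS gM => x /[apply] gM; rewrite normrM mulrC ler_wpM2r.
Qed.

(** Turns convergence of the extended-real norm into convergence of a real number, where
    Cauchy-Schwarz and the limit lemmas can be used. *)
Lemma Lnorm2_cvg0 (f : nat -> T -> R) : (forall k, L2 (f k)) ->
  (Lnorm mu 2%:E (EFin \o f k \_ D) @[k --> \oo] --> 0%E) <->
  (dot (f k) (f k) @[k --> \oo] --> (0 : R)).
Proof.
move=> f2.
have E k : Lnorm mu 2%:E (EFin \o f k \_ D) = (Num.sqrt (dot (f k) (f k)))%:E.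
  by apply: Lnorm2_patch => //; have /(Lfun2_patch _ mD)[] := f2 k.
under eq_fun do rewrite E.
rewrite -[X in _ --> X]/(0%:E); split=> [/fine_cvg|] h.
  have : (Num.sqrt (dot (f k) (f k)) * Num.sqrt (dot (f k) (f k))) @[k --> \oo] --> (0 * 0 : R).
    by apply: cvgM.
  by rewrite mul0r; under eq_fun do rewrite -expr2 sqr_sqrtr ?dot_ge0//.
apply: cvg_EFin; first exact: nearW.
rewrite -[X in _ --> X](sqrtr0 R).
by apply: (cvg_comp _ Num.sqrt h); exact: sqrt_continuous.
Qed.

Lemma dot_cvg (f : nat -> T -> R) u g : (forall k, L2 (f k)) -> L2 u -> L2 g ->
  Lnorm mu 2%:E (EFin \o (f k \- u) \_ D) @[k --> \oo] --> 0%E ->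
  dot (f k) g @[k --> \oo] --> dot u g.
Proof.
move=> f2 u2 g2 /(Lnorm2_cvg0 (fun k => Lfun2_sub (f2 k) u2)) fu.
apply/subr_cvg0/cvgr0Pnorm_le => e e0.
have : (dot (f k \- u) (f k \- u) * dot g g) @[k --> \oo] --> (0 * dot g g : R).
  by apply: cvgM => //; exact: cvg_cst.
rewrite mul0r => /cvgr0Pnorm_le/(_ (e ^+ 2) (exprn_gt0 _ e0)); apply: filterS => k.
rewrite ger0_norm ?mulr_ge0 ?dot_ge0// => h.
rewrite -dot_sub; [|exact: Lfun2_mul_integrable..].
rewrite -(@ler_pXn2r _ 2) ?nnegrE ?(ltW e0)// real_normK ?num_real//.
by apply: le_trans h; apply: dot_CS => //; exact: Lfun2_sub.
Qed.

End finite_measure_Lp.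

(** * Spectral expansion and the L^2 resolvent *)

(** Bounds lam_j / |lam_j - l| by 1/r for all j: beyond 2|l| + 1 this quotient is at most 2, and
    only finitely many eigenvalues remain. *)
Lemma spectral_gap (R : realType) (lam : nat -> R) (l : R) :
  (forall j, 0 < lam j) -> lam j @[j --> \oo] --> +oo -> (forall j, lam j != l) ->
  exists2 r, 0 < r & forall j, r * lam j <= `|lam j - l|.
Proof.
move=> lam0 lamoo laml.
have [N _ NP] : \forall j \near \oo, 2 * `|l| + 1 <= lam j by move/cvgryPge: lamoo; apply.
have [r r0 rP] : exists2 r, 0 < r & forall j, (j < N)%N -> r * lam j <= `|lam j - l|.
  elim: N {NP} => [|N [r r0 IH]]; first by exists 1.
  exists (Num.min r (`|lam N - l| / lam N)).
    by rewrite lt_min r0 divr_gt0// normr_gt0 subr_eq0.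
  move=> j; rewrite ltnS leq_eqVlt => /predU1P[->|/IH h].
    by rewrite -ler_pdivlMr// ge_min lexx orbT.
  by apply: le_trans h; rewrite ler_wpM2r ?(ltW (lam0 j))// ge_min lexx.
exists (Num.min r 2^-1); first by rewrite lt_min r0 invr_gt0 ltr0n.
move=> j; have [/rP h|/NP /= h] := ltnP j N.
  by apply: le_trans h; rewrite ler_wpM2r ?(ltW (lam0 j))// ge_min lexx.
apply: (@le_trans _ _ (2^-1 * lam j)).
  by rewrite ler_wpM2r ?(ltW (lam0 j))// ge_min lexx orbT.
have := ler_norm (lam j - l); have := ler_norm l; lra.
Qed.

Section spectral.
Context d (T : measurableType d) (R : realType) (mu : {measure set T -> \bar R}).
Context (D : set T) (mD : measurable D) (muD : (mu D < +oo)%E).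
Implicit Types f g h u : T -> R.

Local Notation L2 f := (f \_ D \in Lfun mu 2%:E).
Local Notation N2 f := (Lnorm mu 2%:E (EFin \o f \_ D)).
Local Notation dot f g := (\int[mu]_(x in D) (f x * g x))%R.

Context (K : (T -> R) -> T -> R) (lam : nat -> R) (phi : nat -> T -> R).
Hypothesis K2 : forall f, L2 f -> L2 (K f).
Hypothesis Ksym : forall f g, L2 f -> L2 g -> dot (K f) g = dot f (K g).
Hypothesis Kcpt : forall (f : nat -> T -> R) (M : R),
  (forall k, L2 (f k)) -> (forall k, (N2 (f k) <= M%:E)%E) ->
  exists (e : nat -> nat) u, [/\ forall k, (e k < e k.+1)%N, L2 u &
    N2 (K (f (e k)) \- u) @[k --> \oo] --> 0%E].
Hypothesis lam_gt0 : forall j, 0 < lam j.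
Hypothesis lam_oo : lam j @[j --> \oo] --> +oo.
Hypothesis phi2 : forall j, L2 (phi j).
Hypothesis phi_orth : forall i j, dot (phi i) (phi j) = (i == j)%:R.
Hypothesis phi_tot : forall f, L2 f ->
  N2 (f \- (fun x => \sum_(j < N) dot f (phi j) * phi j x)) @[N --> \oo] --> 0%E.
Hypothesis phi_eig : forall j, {ae mu, forall x, D x -> phi j x = lam j * K (phi j) x}.

Let int2 f g : L2 f -> L2 g -> mu.-integrable D (EFin \o (fun x => f x * g x)).
Proof. exact: Lfun2_mul_integrable. Qed.

Let comb (c : nat -> R) N : T -> R := fun x => \sum_(j < N) c j * phi j x.

Let comb2 c N : L2 (comb c N).
Proof. by apply: (Lfun2_sum mD muD N (f := fun j x => c j * phi j x)) => j; exact: Lfun2_scale. Qed.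

Let dot_comb c N h : L2 h -> dot (comb c N) h = \sum_(j < N) c j * dot (phi j) h.
Proof.
move=> h2; rewrite (dot_sum mD muD N (f := fun j x => c j * phi j x))//; last first.
  by move=> j; exact: Lfun2_scale.
by apply: eq_bigr => j _; rewrite dot_scale//; exact: int2.
Qed.

Let dot_comb_phi c N k : dot (comb c N) (phi k) = if (k < N)%N then c k else 0.
Proof.
rewrite dot_comb//; case: ifPn => kN.
  rewrite (bigD1 (Ordinal kN))//= phi_orth eqxx mulr1 big1 ?addr0// => j.
  by rewrite -val_eqE /= => jk; rewrite phi_orth (negbTE jk) mulr0.
rewrite big1// => j _; rewrite phi_orth (_ : (nat_of_ord j == k) = false) ?mulr0//.
by apply: contraNF kN => /eqP <-.
Qed.

Lemma dot_eigenfun f j : L2 f -> dot (K f) (phi j) = dot f (phi j) / lam j.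
Proof.
move=> f2; rewrite Ksym//; have lj := lt0r_neq0 (lam_gt0 j).
have Kp2 := K2 (phi2 j).
suff -> : dot f (phi j) = lam j * dot f (K (phi j)) by rewrite mulrC mulKf.
rewrite (dotC mu D f (K _)) -dot_scale ?int2// (dotC mu D f).
by apply: dot_ae_eql => //; exact: Lfun2_scale.
Qed.

(** Only [f] is expanded: its remainder tends to 0 in L^2, hence so does its pairing with the fixed
    [g]. *)
Lemma parseval f g : L2 f -> L2 g ->
  \sum_(j < N) dot f (phi j) * dot g (phi j) @[N --> \oo] --> dot f g.
Proof.
move=> f2 g2.
have h : dot (f \- comb (fun j => dot f (phi j)) N) g @[N --> \oo] --> dot (cst 0) g.
  apply: dot_cvg => //; [by move=> k; exact: Lfun2_sub|exact: Lfun2_0|].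
  apply: cvg_trans (phi_tot f2); apply: near_eq_cvg; apply: nearW => N.
  by congr (Lnorm _ _ (_ \o _ \_ _)); apply/funext => x /=; rewrite subr0.
have E N : \sum_(j < N) dot f (phi j) * dot g (phi j) =
    dot f g - dot (f \- comb (fun j => dot f (phi j)) N) g.
  rewrite dot_sub ?int2// subKr dot_comb//.
  by apply: eq_bigr => j _; rewrite (dotC _ _ (phi j)).
have d0 : dot (cst 0) g = 0.
  by rewrite (eq_Rintegral mu (g := cst 0)) ?Rintegral_cst ?mul0r// => x _; rewrite mul0r.
rewrite d0 in h; have {}h : dot f g - dot (f \- comb (fun j => dot f (phi j)) N) g @[N --> \oo] -->
    (dot f g - 0 : R) by apply: cvgB => //; exact: cvg_cst.
rewrite subr0 in h; apply: cvg_trans h.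
by apply: near_eq_cvg; apply: nearW => N; rewrite /= E.
Qed.

Lemma bessel f N : L2 f -> \sum_(j < N) dot f (phi j) ^+ 2 <= dot f f.
Proof.
move=> f2; pose s N := \sum_(j < N) dot f (phi j) ^+ 2.
have sf : s N @[N --> \oo] --> dot f f.
  apply: cvg_trans (parseval f2 f2); apply: near_eq_cvg; apply: nearW => m.
  by apply: eq_bigr => j _; rewrite expr2.
rewrite -(cvg_lim (@Rhausdorff R) sf); apply: (@nondecreasing_cvgn_le _ s).
  by apply/nondecreasing_seqP => m; rewrite /s big_ord_recr lerDl; exact: sqr_ge0.
by apply/cvg_ex; exists (dot f f).
Qed.

Lemma coef_inj f g : L2 f -> L2 g -> (forall j, dot f (phi j) = dot g (phi j)) ->
  {ae mu, forall x, D x -> f x = g x}.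
Proof.
move=> f2 g2 fg; have fg2 := Lfun2_sub mD f2 g2.
have : {ae mu, forall x, D x -> (f \- g) x = 0}.
  apply: dot_eq0 => //; apply: (cvg_unique (@Rhausdorff R) (parseval fg2 fg2)).
  have h0 : cst (0 : R) @ \oo --> (0 : R) by exact: cvg_cst.
  apply: cvg_trans h0; apply: near_eq_cvg; apply: nearW => N.
  by rewrite big1// => j _; rewrite dot_sub ?int2// fg subrr mul0r.
by apply: filterS => x /[apply] /eqP; rewrite subr_eq0 => /eqP.
Qed.

Section resolvent.
Context (l : R).
Hypothesis laml : forall j, lam j != l.

Let expansion f N := fun x => \sum_(j < N) dot f (phi j) / (lam j - l) * phi j x.

(** L^2 convergence passes to each coefficient, and the j-th coefficient of the partial sums is
    constant once N > j. *)
Lemma resolvent_coef f u j : L2 u -> N2 (u \- expansion f N) @[N --> \oo] --> 0%E ->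
  dot u (phi j) = dot f (phi j) / (lam j - l).
Proof.
move=> u2 ue; pose c i := dot f (phi i) / (lam i - l).
have h : dot (comb c N) (phi j) @[N --> \oo] --> dot u (phi j).
  apply: dot_cvg => //; apply: cvg_trans ue; apply: near_eq_cvg; apply: nearW => N.
  rewrite -[in LHS](@oppe_Lnorm _ _ _ mu); congr (Lnorm _ _ _); apply/funext => x /=.
  by rewrite !patchE; case: ifPn => _ /=; rewrite ?oppr0//= opprB.
have {}h := cvg_lim (@Rhausdorff R) h; rewrite -h.
apply: lim_near_cst => //; exists j.+1 => //= N jN.
by rewrite dot_comb_phi jN.
Qed.

(* No completeness of L^2 is needed: the partial sums of the expansion are the
   images under the compact K of a bounded sequence. *)
Lemma resolvent_exists f : L2 f ->
  exists2 u, L2 u & N2 (u \- expansion f N) @[N --> \oo] --> 0%E.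
Proof.
move=> f2; have [r r0 rP] := spectral_gap lam_gt0 lam_oo laml.
pose c i := dot f (phi i) / (lam i - l).
(* [K] divides the i-th coefficient by [lam i], so [K (v N)] has the coefficients of the N-th
   partial sum of the expansion. The [v N] are bounded in L^2 by [spectral_gap] and Bessel. *)
pose v N := comb (fun i => lam i * c i) N.
have cle i : (lam i * c i) ^+ 2 <= r^-1 ^+ 2 * dot f (phi i) ^+ 2.
  rewrite -exprMn -(real_normK (num_real (lam i * _))).
  rewrite -(real_normK (num_real (r^-1 * _))) lerXn2r ?nnegrE//.
  rewrite /c mulrCA !normrM normfV mulrC ler_wpM2r//.
  have li := lam_gt0 i; have lli : 0 < `|lam i - l| by rewrite normr_gt0 subr_eq0.
  by rewrite (gtr0_norm li) normfV (gtr0_norm r0) ler_pdivrMr// ler_pdivlMl.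
have vM N : (N2 (v N) <= (Num.sqrt (r^-1 ^+ 2 * dot f f))%:E)%E.
  rewrite Lnorm2_patch//; last by have /(Lfun2_patch _ mD)[] := comb2 (fun i => lam i * c i) N.
  rewrite lee_fin ler_wsqrtr// dot_comb; last exact: comb2.
  apply: (@le_trans _ _ (\sum_(j < N) r^-1 ^+ 2 * dot f (phi j) ^+ 2)).
    apply: ler_sum => j _; rewrite dotC dot_comb_phi ltn_ord -expr2; exact: cle.
  by rewrite -mulr_sumr ler_wpM2l ?sqr_ge0//; exact: bessel.
have [e [u [einc u2 eu]]] := Kcpt (fun N => comb2 (fun i => lam i * c i) N) vM.
exists u => //.
have uc j : dot u (phi j) = c j.
  have h : dot (K (v (e k))) (phi j) @[k --> \oo] --> dot u (phi j).
    by apply: dot_cvg => // k; apply: K2; exact: comb2.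
  have ek k : (k <= e k)%N by elim: k => // k kek; exact: leq_ltn_trans kek (einc k).
  have {}h := cvg_lim (@Rhausdorff R) h; rewrite -h.
  apply: lim_near_cst => //; exists j.+1 => //= k jk.
  rewrite dot_eigenfun; last exact: comb2.
  by rewrite dot_comb_phi (leq_trans jk (ek k)) mulrC mulKf ?gt_eqF.
(* Compactness gave only a subsequence, but [u] has the coefficients [c], so its own expansion is
   the full sequence of partial sums. *)
apply: cvg_trans (phi_tot u2); apply: near_eq_cvg; apply: nearW => N.
by congr (Lnorm _ _ (_ \o _ \_ _)); apply/funext => x /=; under eq_bigr do rewrite uc.
Qed.

Context (Res : (T -> R) -> T -> R).
Hypothesis Res2 : forall f, L2 f -> L2 (Res f).
Hypothesis ResE : forall f, L2 f -> N2 (Res f \- expansion f N) @[N --> \oo] --> 0%E.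

Lemma resolvent_sym f g : L2 f -> L2 g -> dot (Res f) g = dot f (Res g).
Proof.
move=> f2 g2; have h1 := parseval (Res2 f2) g2; have h2 := parseval f2 (Res2 g2).
apply: (cvg_unique (@Rhausdorff R) h1); apply: cvg_trans h2.
apply: near_eq_cvg; apply: nearW => N /=; apply: eq_bigr => j _.
rewrite (resolvent_coef j (Res2 f2) (ResE f2)) (resolvent_coef j (Res2 g2) (ResE g2)).
by rewrite mulrAC mulrA.
Qed.

(** Both sides have the same coefficients: with a = <f, phi_j>, one has (a + l a/(lam_j - l)) /
    lam_j = a/(lam_j - l). *)
Lemma resolvent_fixpoint f : L2 f ->
  {ae mu, forall x, D x -> Res f x = K (fun y => f y + l * Res f y) x}.
Proof.
move=> f2; have F2 : L2 (fun y => f y + l * Res f y).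
  by apply: Lfun2_add => //; apply: Lfun2_scale => //; exact: Res2.
apply: coef_inj; [exact: Res2|exact: K2|move=> j].
rewrite dot_eigenfun//.
have -> : dot (fun y => f y + l * Res f y) (phi j) = dot (fun y => 1 * f y + l * Res f y) (phi j).
  by apply: eq_Rintegral => x _; rewrite mul1r.
rewrite dot_lin ?int2 ?Res2// (resolvent_coef j (Res2 f2) (ResE f2)).
have lj := lt0r_neq0 (lam_gt0 j); have llj := laml j; field.
by rewrite lj subr_eq0.
Qed.

End resolvent.

End spectral.

(** * Completeness of L^1, approximation, and weak limits from coefficients *)

Lemma cvg0_exists_le (R : realType) (a : nat -> R) (e : R) :
  a @ \oo --> (0 : R) -> 0 < e -> exists k, a k <= e.
Proof.
move=> /cvgrPdist_le a0 /a0[k _ /(_ k (leqnn k)) /= ke].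
by exists k; apply: le_trans ke; rewrite sub0r normrN ler_norm.
Qed.

Lemma cvg_sum_ord (R : realType) (S : Type) (F : set_system S) (N : nat)
    (f : nat -> S -> R) (l : nat -> R) : Filter F ->
  (forall j, f j s @[s --> F] --> l j) ->
  \sum_(j < N) f j s @[s --> F] --> \sum_(j < N) l j.
Proof.
move=> FF fl; elim: N => [|N IH].
  by under eq_fun do rewrite big_ord0; rewrite big_ord0; exact: cvg_cst.
by under eq_fun do rewrite big_ord_recr; rewrite big_ord_recr; exact: cvgD.
Qed.

Section L1_approximation.
Context d (T : measurableType d) (R : realType) (mu : {measure set T -> \bar R}).
Context (D : set T) (mD : measurable D) (muD : (mu D < +oo)%E).
Implicit Types f g h u : T -> R.

Local Notation L1 f := (f \_ D \in Lfun mu 1).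
Local Notation L2 f := (f \_ D \in Lfun mu 2%:E).
Local Notation Loo f := (f \_ D \in Lfun mu +oo%E).
Local Notation N2 f := (Lnorm mu 2%:E (EFin \o f \_ D)).
Local Notation dot f g := (\int[mu]_(x in D) (f x * g x))%R.

Lemma integrable_normr f : mu.-integrable D (EFin \o f) ->
  mu.-integrable D (EFin \o (fun x => `|f x|)).
Proof. exact: integrable_abse. Qed.

Lemma Rintegral_dist_triangle f g h : mu.-integrable D (EFin \o f) ->
  mu.-integrable D (EFin \o g) -> mu.-integrable D (EFin \o h) ->
  (\int[mu]_(x in D) `|f x - h x| <=
   \int[mu]_(x in D) `|f x - g x| + \int[mu]_(x in D) `|g x - h x|)%R.
Proof.
move=> fi gi hi; rewrite -RintegralD//; [|exact/integrable_normr/integrable_EFinB..].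
apply: le_Rintegral => //.
- exact/integrable_normr/integrable_EFinB.
- by apply: integrable_EFinD => //; exact/integrable_normr/integrable_EFinB.
- by move=> x _; exact: ler_distD.
Qed.

Lemma EFin_Rintegral f : mu.-integrable D (EFin \o f) ->
  ((\int[mu]_(x in D) f x)%R%:E = \int[mu]_(x in D) (f x)%:E)%E.
Proof. by move=> fi; rewrite fineK//; exact: integrable_fin_num. Qed.

(** The Riesz-Fischer argument: along indices with summable rates the increments are dominated by an
    integrable series, so the limit exists a.e. and in L^1. The Cauchy bound [a i + a j] is the form
    produced when both terms approximate one fixed function. *)
Lemma L1_complete (h : nat -> T -> R) (a : nat -> R) :
  (forall k, mu.-integrable D (EFin \o h k)) -> a @ \oo --> (0 : R) ->
  (forall i j, (\int[mu]_(x in D) `|h i x - h j x|)%R <= a i + a j) ->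
  exists2 u, mu.-integrable D (EFin \o u) &
    forall k, (\int[mu]_(x in D) `|h k x - u x|)%R <= a k.
Proof.
move=> hi a0 ha.
have hBi i j : mu.-integrable D (EFin \o (fun x => `|h i x - h j x|)).
  exact/integrable_normr/integrable_EFinB.
(* [e] need not be increasing; only the rates [a (e i)] matter. *)
have /choice[e ePle] : forall i : nat, exists k, a k <= 2^-1 ^+ i.
  by move=> i; apply: cvg0_exists_le => //; rewrite exprn_gt0.
pose g i x := `|h (e i.+1) x - h (e i) x|.
have g0 i x : 0 <= g i x by exact: normr_ge0.
have gle i : (\int[mu]_(x in D) g i x)%R <= 2 * 2^-1 ^+ i.
  apply: (le_trans (ha _ _)); rewrite mulr_natl mulr2n lerD//.
  by apply: (le_trans (ePle _)); rewrite exprS ler_piMl ?exprn_ge0// invf_le1// ler1n.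
have mg i : measurable_fun D (EFin \o g i) by exact: measurable_int (hBi _ _).
pose S x : \bar R := (\sum_(0 <= i <oo) (g i x)%:E)%E.
have S0 x : (0 <= S x)%E by apply: nneseries_ge0 => i _ _; rewrite lee_fin.
have Si : mu.-integrable D S.
  apply/integrableP; split.
    by apply: ge0_emeasurable_sum => [k x _ _|k _]; [rewrite lee_fin|exact: mg].
  under eq_integral do rewrite gee0_abs//.
  rewrite integral_nneseries//; last by move=> i x _; rewrite lee_fin.
  apply: (@le_lt_trans _ _ (\sum_(0 <= i <oo) (2 * 2^-1 ^+ i)%:E)%E).
    apply: lee_nneseries => [i _ _|i _]; first by apply: integral_ge0 => x _; rewrite lee_fin.
    by rewrite -EFin_Rintegral; [rewrite lee_fin; exact: gle|exact: hBi].
  by apply: geometric_nneseries_lty => //; rewrite invr_ge0 ler0n invf_lt1// ltr1n.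
have Sle x n : ((\sum_(i < n) g i x)%:E <= S x)%E.
  rewrite -sumEFin -(big_mkord xpredT (fun i => (g i x)%:E)).
  by apply: nneseries_lim_ge => i _; rewrite lee_fin.
pose v x := limn_esup (fun n => (h (e n) x)%:E).
pose u x := fine (v x).
have hcvg x : S x \is a fin_num -> h (e n) x @[n --> \oo] --> u x.
  move=> Sx.
  have cs : cvgn (series (fun i => h (e i.+1) x - h (e i) x)).
    apply: normed_cvg; apply: (@nnseries_is_cvg _ (fun i => g i x)) => //.
    by move: Sx; rewrite fin_numElt => /andP[].
  have ch : cvgn (fun n => h (e n) x).
    have -> : (fun n => h (e n) x) =
        (series (fun i => h (e i.+1) x - h (e i) x)) \+ cst (h (e 0%N) x).
      by apply/funext => n /=; rewrite /series/= telescope_sumr// subrK.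
    by apply: is_cvgD => //; exact: is_cvg_cst.
  have cE : (h (e n) x)%:E @[n --> \oo] --> (limn (fun n => h (e n) x))%:E.
    by apply: cvg_EFin => //; exact: nearW.
  rewrite /u /v is_cvg_limn_esupE; last by apply/cvg_ex; eexists; exact: cE.
  by rewrite (cvg_lim _ cE).
have [] := @dominated_convergence _ _ _ mu D mD (fun n => EFin \o h (e n)) (EFin \o u)
  (fun x => `|(h (e 0%N) x)%:E| + S x)%E.
- by move=> n; exact: measurable_int (hi _).
- apply/measurable_EFinP; apply: measurableT_comp; first exact: fine_measurable.
  by apply: measurable_fun_limn_esup => n; exact: measurable_int (hi _).
- apply: filterS (integrable_ae mD Si) => x /[apply] Sx.
  by apply: cvg_EFin; [exact: nearW|exact: hcvg].
- exact: (integrableD mD (integrable_abse (hi (e 0%N))) Si).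
- apply: nearW => x n _ /=.
  have -> : h (e n) x = h (e 0%N) x + \sum_(i < n) (h (e i.+1) x - h (e i) x).
    rewrite -(big_mkord xpredT (fun i => h (e i.+1) x - h (e i) x)).
    by rewrite telescope_sumr// subrKC.
  apply: (@le_trans _ _ (`|h (e 0%N) x|%:E + (\sum_(i < n) g i x)%:E)%E); last exact: leeD2l.
  by rewrite -EFinD lee_fin (le_trans (ler_normD _ _))// lerD2l ler_norm_sum.
move=> ui hu _; exists u => // k.
have hui n : mu.-integrable D (EFin \o (fun x => `|h n x - u x|)).
  exact/integrable_normr/integrable_EFinB.
have ue : (\int[mu]_(x in D) `|h (e n) x - u x|)%R @[n --> \oo] --> (0 : R).
  move/fine_cvg: hu; apply: cvg_trans; apply: near_eq_cvg; apply: nearW => n.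
  by congr fine; apply: eq_integral.
have ae0 : a (e n) @[n --> \oo] --> (0 : R).
  have h2 : (2^-1 ^+ n : R) @[n --> \oo] --> (0 : R).
    by apply: cvg_expr; rewrite ger0_norm ?invr_ge0// invf_lt1// ltr1n.
  (* The Cauchy bound with i = j reads 0 <= 2 a_i, which supplies the missing sign of [a]. *)
  apply: (squeeze_cvgr _ (cvg_cst 0) h2); apply: nearW => n; rewrite ePle andbT.
  have := ha (e n) (e n); have : 0 <= (\int[mu]_(x in D) `|h (e n) x - h (e n) x|)%R.
    exact: Rintegral_ge0.
  lra.
have lim : a k + a (e n) + (\int[mu]_(x in D) `|h (e n) x - u x|)%R @[n --> \oo] --> (a k + 0 + 0 : R).
  by apply: cvgD => //; apply: cvgD => //; exact: cvg_cst.
rewrite !addr0 in lim; rewrite -(cvg_lim (@Rhausdorff R) lim).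
apply: limr_ge; first by apply/cvg_ex; exists (a k).
apply: nearW => n; apply: (le_trans (Rintegral_dist_triangle (hi k) (hi (e n)) ui)).
by rewrite lerD2r.
Qed.

Lemma Lfun1_truncation f : L1 f -> exists t : nat -> T -> R,
  (forall k, Loo (t k)) /\
  (\int[mu]_(x in D) `|t k x - f x|)%R @[k --> \oo] --> (0 : R).
Proof.
move=> /(Lfun1_patch _ mD) fi.
have mf : measurable_fun D f by apply/measurable_EFinP; exact: measurable_int fi.
pose t (k : nat) x := Num.max (- k%:R) (Num.min (f x) k%:R).
have tf k x : `|f x| <= k%:R -> t k x = f x.
  rewrite ler_norml => /andP[fk1 fk2]; rewrite /t.
  by rewrite (min_idPl fk2) (max_idPr fk1).
have mt k : measurable_fun D (t k).
  by apply: measurable_maxr => //; exact: measurable_minr.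
exists t; split.
  move=> k; apply/Lfuny_patch => //; split => //; exists k%:R => //; apply: nearW => x _.
  by rewrite /t ler_norml le_max lexx/= ge_max ge_min lexx orbT andbT ge0_cp.
have [] := @dominated_convergence _ _ _ mu D mD (fun k => EFin \o t k) (EFin \o f)
  (fun x => `|(f x)%:E|%E).
- by move=> k; apply/measurable_EFinP.
- exact/measurable_EFinP.
- apply: nearW => x _; apply: cvg_EFin; first exact: nearW.
  apply: cvg_near_cst; near=> k; apply: tf; near: k; exact: nbhs_infty_ger.
- exact: integrable_abse.
- apply: nearW => x k _; rewrite /= lee_fin.
  have [/tf ->//|kf] := leP `|f x| k%:R.
  apply: le_trans (ltW kf); rewrite ler_norml /t le_max lexx/= ge_max ge_min lexx orbT andbT.
  by rewrite ge0_cp.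
move=> _ h _; move/fine_cvg: h; apply: cvg_trans; apply: near_eq_cvg; apply: nearW => k.
by congr fine; apply: eq_integral.
Unshelve. all: by end_near. Qed.

Lemma sign_test_function f : measurable_fun D f -> exists psi : T -> R,
  [/\ measurable_fun D psi, forall x, `|psi x| <= 1 &
      forall x, D x -> f x * psi x = `|f x|].
Proof.
move=> mf; pose P := D `&` f @^-1` `[0, +oo[%classic.
have mP : measurable P by apply: mf => //; exact: measurable_itv.
exists (fun x => 2 * \1_P x - 1); split.
- by apply: measurable_funB => //; apply: measurable_funM => //; exact: measurable_indic.
- move=> x; rewrite indicE; case: (x \in P); rewrite ?mulr1 ?mulr0 ?sub0r ?normrN ?normr1//.
  by rewrite (_ : 2 - 1 = 1) ?normr1//; lra.
- move=> x Dx; rewrite indicE; have [f0|f0] := leP 0 (f x).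
    rewrite mem_set; last by split=> //=; rewrite in_itv/= f0.
    by rewrite ger0_norm// mulr1 (_ : 2 - 1 = 1) ?mulr1//; lra.
  rewrite memNset; first by rewrite ltr0_norm// mulr0 sub0r mulrN1.
  by move=> [_ /=]; rewrite in_itv/= andbT leNgt f0.
Qed.

Lemma dot_cvg_L1 (S : Type) (F : set_system S) (FF : Filter F)
    (g : S -> T -> R) (g1 : T -> R) (psi : T -> R) :
  (\forall s \near F, L1 (g s)) -> L1 g1 -> Loo psi ->
  (\int[mu]_(x in D) `|g s x - g1 x|)%R @[s --> F] --> (0 : R) ->
  dot (g s) psi @[s --> F] --> dot g1 psi.
Proof.
move=> gL1 g1L1 psioo gg1.
have [mpsi [M M0 psiM]] := (Lfuny_patch mu mD psi).1 psioo.
apply/cvgrPdist_le => e e0.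
have eM : 0 < e / (M + 1) by rewrite divr_gt0// ltr_wpDl.
move/cvgrPdist_le: gg1 => /(_ _ eM) gg1; near=> s.
have gs1 : L1 (g s) by near: s.
have hs : `|0 - (\int[mu]_(x in D) `|g s x - g1 x|)%R| <= e / (M + 1) by near: s.
rewrite distrC -dot_sub//; [|exact: Lfun1_mul_Lfuny_integrable..].
apply: (le_trans (dot_le_L1_Loo mD (Lfun1_sub mD gs1 g1L1) mpsi M0 psiM)).
move: hs; rewrite sub0r normrN ger0_norm; last exact: Rintegral_ge0.
rewrite ler_pdivlMr ?ltr_wpDl// => /(le_trans _); apply.
by rewrite mulrC ler_wpM2l ?Rintegral_ge0// lerDl.
Unshelve. all: by end_near. Qed.

(** An e/3 argument: [f] is replaced by a truncation (L^1 against the sup bound), the truncation by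
    a finite eigenfunction sum (Cauchy-Schwarz), and on the finite sum the coefficients converge.
    The first two errors are uniform in s thanks to [M]. *)
Lemma weak_cvg_of_coef (phi : nat -> T -> R) (S : Type) (F : set_system S)
    (FF : Filter F) (u : S -> T -> R) (u1 : T -> R) (M : R) : 0 <= M ->
  (forall j, L2 (phi j)) ->
  (forall f, L2 f ->
    N2 (f \- (fun x => \sum_(j < N) dot f (phi j) * phi j x)) @[N --> \oo] --> 0%E) ->
  (\forall s \near F, measurable_fun D (u s) /\ {ae mu, forall x, D x -> `|u s x| <= M}) ->
  measurable_fun D u1 -> {ae mu, forall x, D x -> `|u1 x| <= M} ->
  (forall j, dot (phi j) (u s) @[s --> F] --> dot (phi j) u1) ->
  forall f, L1 f -> dot f (u s) @[s --> F] --> dot f u1.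
Proof.
move=> M0 phi2 phi_tot uM mu1 u1M uphi f f1; apply/cvgrPdist_le => e e0.
have u1oo : Loo u1 by apply/Lfuny_patch => //; split=> //; exists M.
have [t [too tf]] := Lfun1_truncation f1.
(* 2M bounds the difference of two functions bounded by M; the added 1 keeps the denominator
   positive when M = 0. *)
have e3 : 0 < e / 3 / (2 * M + 1) by rewrite !divr_gt0// ltr_wpDl// mulr_ge0.
have [k tk] := cvg0_exists_le tf e3.
have tk2 : L2 (t k) by exact: Lfuny_Lfun2.
pose c j := dot (t k) (phi j).
pose q N : T -> R := t k \- (fun x => \sum_(j < N) c j * phi j x).
have sum2 N : L2 (fun x => \sum_(j < N) c j * phi j x).
  by apply: (Lfun2_sum mD muD N (f := fun j x => c j * phi j x)) => j; exact: Lfun2_scale.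
have q2 N : L2 (q N) by exact: Lfun2_sub.
have /(Lnorm2_cvg0 mD q2) qcvg := phi_tot _ tk2.
(* Bounds <w, w> for w = u1 - u_s, whatever s; so [N] can be fixed before s. *)
pose B := (\int[mu]_(x in D) (2 * M) ^+ 2)%R.
have B0 : 0 <= B by apply: Rintegral_ge0 => x _; exact: sqr_ge0.
have [N qB] : exists N, dot (q N) (q N) * B <= (e / 3) ^+ 2.
  have h : dot (q N) (q N) * B @[N --> \oo] --> (0 * B : R).
    by apply: cvgM => //; exact: cvg_cst.
  have e32 : 0 < (e / 3) ^+ 2 by rewrite exprn_gt0// divr_gt0.
  by rewrite mul0r in h; exact: cvg0_exists_le h e32.
have scvg : \sum_(j < N) c j * dot (phi j) (u s) @[s --> F] -->
    \sum_(j < N) c j * dot (phi j) u1.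
  have := @cvg_sum_ord R S F N (fun j s => c j * dot (phi j) (u s))
    (fun j => c j * dot (phi j) u1) FF.
  by apply => j; apply: cvgM => //; exact: cvg_cst.
have e33 : 0 < e / 3 by rewrite divr_gt0.
move/cvgrPdist_le: scvg => /(_ _ e33) scvg.
near=> s.
have [mus usM] : measurable_fun D (u s) /\ {ae mu, forall x, D x -> `|u s x| <= M}.
  by near: s.
have ss : `|\sum_(j < N) c j * dot (phi j) u1 - \sum_(j < N) c j * dot (phi j) (u s)| <= e / 3.
  by near: s.
have usoo : Loo (u s) by apply/Lfuny_patch => //; split=> //; exists M.
have us2 := Lfuny_Lfun2 mD muD usoo; have u12 := Lfuny_Lfun2 mD muD u1oo.
pose w : T -> R := u1 \- u s.
have mw : measurable_fun D w by exact: measurable_funB.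
have wM : {ae mu, forall x, D x -> `|w x| <= 2 * M}.
  apply: filterS2 usM u1M => x h1 h2 Dx; move: (h1 Dx) (h2 Dx) => {}h1 {}h2.
  by rewrite /w /= (le_trans (ler_normB _ _))// mulr_natl mulr2n lerD.
have w2 : L2 w by exact: Lfun2_sub.
have woo : Loo w by apply/Lfuny_patch => //; split=> //; exists (2 * M); rewrite ?mulr_ge0.
have t1 := Lfun2_Lfun1 mD muD tk2.
have sE : \sum_(j < N) c j * dot (phi j) u1 - \sum_(j < N) c j * dot (phi j) (u s) =
    dot (fun x => \sum_(j < N) c j * phi j x) w.
  rewrite (dot_sum mD muD N (f := fun j x => c j * phi j x))//; last by move=> j; exact: Lfun2_scale.
  rewrite -sumrB; apply: eq_bigr => j _.
  rewrite dot_scale//; last exact: Lfun2_mul_integrable.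
  by rewrite -mulrBr !(dotC mu D (phi j)) dot_sub//; exact: Lfun2_mul_integrable.
have E : dot f u1 - dot f (u s) = dot (f \- t k) w + dot (q N) w +
    (\sum_(j < N) c j * dot (phi j) u1 - \sum_(j < N) c j * dot (phi j) (u s)).
  rewrite dot_sub//; [|exact: Lfun1_mul_Lfuny_integrable..].
  rewrite (@dot_sub _ _ _ mu D mD (t k))//; [|exact: Lfun2_mul_integrable..].
  rewrite sE (dotC mu D f w) dot_sub//; last 2 first.
  - by under eq_fun do rewrite mulrC; exact: Lfun1_mul_Lfuny_integrable.
  - by under eq_fun do rewrite mulrC; exact: Lfun1_mul_Lfuny_integrable.
  rewrite (dotC mu D u1) (dotC mu D (u s)); ring.
rewrite E (le_trans (ler_normD _ _))// [leRHS](_ : e = e / 3 + e / 3 + e / 3); last by lra.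
rewrite lerD// (le_trans (ler_normD _ _))// lerD//.
  have ftk := Lfun1_sub mD f1 t1.
  apply: (le_trans (dot_le_L1_Loo mD ftk mw _ wM)); first by rewrite mulr_ge0.
  have -> : (\int[mu]_(x in D) `|(f \- t k) x| = \int[mu]_(x in D) `|t k x - f x|)%R.
    by apply: eq_Rintegral => x _ /=; rewrite distrC.
  move: tk; rewrite ler_pdivlMr; last by rewrite ltr_wpDl// mulr_ge0.
  move=> /(le_trans _); apply; rewrite mulrC ler_wpM2l ?Rintegral_ge0// lerDl//.
rewrite -(@ler_pXn2r _ 2) ?nnegrE ?(ltW e33)// real_normK ?num_real//.
apply: le_trans qB; apply: (le_trans (dot_CS mD (q2 N) w2)).
rewrite ler_wpM2l ?dot_ge0//; apply: ae_le_Rintegral => //.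
- exact: Lfun2_mul_integrable.
- exact: integrable_cst_fin.
- apply: filterS wM => x /[apply] wx; rewrite -expr2 -(real_normK (num_real (w x))).
  by rewrite lerXn2r ?nnegrE// mulr_ge0.
Unshelve. all: by end_near. Qed.

End L1_approximation.

(** * The resolvent of one operator: bounds, extension to L^1, symmetry *)

Section resolvent_on_domain.
Context (R : realType) (n : nat) (Om : set 'rV[R]_n.+1).
Local Notation V := 'rV[R]_n.+1.
Local Notation T := (lebesgue_mspace R n).
Local Notation mu := (lebesgue_measure_rV R n).
Local Notation dot := (dotL2 Om).
Hypothesis Om_bounded : bounded_set Om.
Hypothesis Om_open : open Om.

Lemma measurable_domain : measurable (Om : set T).
Proof. exact: measurable_open_rV. Qed.

Let mOm := measurable_domain.

Lemma lebesgue_domain_lty : (mu Om < +oo)%E.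
Proof. exact: lebesgue_bounded_lty. Qed.

Let finOm := lebesgue_domain_lty.

Lemma inLp1P (f : V -> R) : inLp Om 1%E f <-> mu.-integrable Om (EFin \o (f : T -> R)).
Proof. exact: (Lfun1_patch mu mOm). Qed.

Lemma inLpyP (f : V -> R) : inLp Om +oo%E f <->
  measurable_fun (Om : set T) (f : T -> R) /\
  exists2 M, 0 <= M & {ae mu, forall x : T, Om x -> `|f x| <= M}.
Proof. exact: (Lfuny_patch mu mOm). Qed.

Lemma inLp2_measurable (f : V -> R) : inLp Om 2%:E f ->
  measurable_fun (Om : set T) (f : T -> R).
Proof. exact: (Lfun2_measurable mOm). Qed.

Lemma inLp21 (f : V -> R) : inLp Om 2%:E f -> inLp Om 1%E f.
Proof. exact: (Lfun2_Lfun1 mOm finOm). Qed.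

Lemma inLpy2 (f : V -> R) : inLp Om +oo%E f -> inLp Om 2%:E f.
Proof. exact: (Lfuny_Lfun2 mOm finOm). Qed.

Lemma normLp1E (f : V -> R) : inLp Om 1%E f ->
  normLp Om 1%E f = (\int[mu]_(x in Om) `|f x|)%R%:E.
Proof.
move=> /inLp1P fi; rewrite (EFin_Rintegral mOm); first exact: (Lnorm1_patch mu Om f).
exact: (integrable_normr fi).
Qed.

Lemma integrable_mul_1y (f g : V -> R) : inLp Om 1%E f -> inLp Om +oo%E g ->
  mu.-integrable Om (EFin \o (fun x : T => f x * g x)).
Proof. exact: (Lfun1_mul_Lfuny_integrable mOm). Qed.

Lemma bdist_powR_inLpy (gam : R) : 0 <= gam -> inLp Om +oo%E (fun x => bdist Om x `^ gam).
Proof.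
move=> g0; apply/inLpyP; split; first exact: measurable_bdist_powR.
have [M [_ OmM]] := Om_bounded.
pose W := bdist Om 0 + n.+1%:R * (`|M| + 1).
exists (W `^ gam); first exact: powR_ge0.
apply: nearW => x Ox; rewrite ger0_norm ?powR_ge0//.
have xW : bdist Om x <= W.
  apply: (le_trans (bdist_le Om 0 x)); rewrite lerD2l sub0r enormN.
  apply: (le_trans (enorm_le_norm _)); rewrite ler_wpM2l//.
  by apply: (OmM (`|M| + 1)) => //; rewrite (le_lt_trans (ler_norm M))// ltrDl.
by apply: ge0_ler_powR; rewrite ?nnegrE ?bdist_ge0// (le_trans _ xW)// bdist_ge0.
Qed.

Context (s gam l C : R) (G : V -> V -> R) (lam : nat -> R) (phi : nat -> V -> R).
Hypothesis mG : forall x, Om x -> measurable_fun (Om : set T) (G x : T -> R).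
Hypothesis Gcpt : compact_selfadjoint_L2 Om (green_op Om G).
Hypothesis Geig : eigenbasis Om G lam phi.
Hypothesis gam0 : 0 < gam.
Hypothesis gam2s : gam < 2 * s.
Hypothesis s2dim : 2 * s < n.+1%:R.
Hypothesis GK1 : K1 Om s gam G.
Hypothesis laml : forall j, lam j != l.

Local Notation Res := (resolvent Om gam lam phi l).

Hypothesis Resoo : forall f, inLp Om +oo%E f ->
  (normLp Om +oo%E (Res f) <= C%:E * normLp Om +oo%E f)%E.

Lemma eigenval_gt0 j : 0 < lam j.
Proof.
case: Geig => -[l0 linc] _ _ _ _; elim: j => // j h; exact: lt_le_trans (linc j).
Qed.

Let K2 : forall f, inLp Om 2%:E f -> inLp Om 2%:E (green_op Om G f).
Proof. by case: Gcpt. Qed.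

(** [get] meets its specification because [resolvent_exists] supplies a witness. *)
Lemma resolvent_L2_spec f : inLp Om 2%:E f -> is_resolvent_L2 Om lam phi l f (Res f).
Proof.
move=> f2; rewrite /resolvent asboolT//; apply: getPex.
case: Gcpt => h1 h2 h3; case: Geig => _ h4 [h5 h6] h7 h8.
have [u u2 hu] := @resolvent_exists _ T R mu Om mOm finOm (green_op Om G) lam phi
  h1 h2 h3 eigenval_gt0 h4 h5 h6 h7 h8 l laml f f2.
by exists u.
Qed.

Lemma resolvent_inLp2 f : inLp Om 2%:E f -> inLp Om 2%:E (Res f).
Proof. by move=> /resolvent_L2_spec[]. Qed.

Let ResE f : inLp Om 2%:E f -> normLp Om 2%:E
    (Res f \- (fun x => \sum_(j < N) dotL2 Om f (phi j) / (lam j - l) * phi j x))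
    @[N --> \oo] --> 0%E.
Proof. by move=> /resolvent_L2_spec[]. Qed.

Lemma resolvent_coefE f j : inLp Om 2%:E f ->
  dot (Res f) (phi j) = dot f (phi j) / (lam j - l).
Proof.
move=> f2; case: Geig => _ _ [h5 h6] _ _.
exact: (@resolvent_coef _ T R mu Om mOm finOm lam phi h5 h6 l f (Res f) j
  (resolvent_inLp2 f2) (ResE f2)).
Qed.

Lemma resolvent_dotC f g : inLp Om 2%:E f -> inLp Om 2%:E g ->
  dot (Res f) g = dot f (Res g).
Proof.
case: Gcpt => h1 h2 h3; case: Geig => _ h4 [h5 h6] h7 h8.
exact: (@resolvent_sym _ T R mu Om mOm finOm lam phi h5 h6 h7 l Res resolvent_inLp2 ResE).
Qed.

Lemma resolvent_green f : inLp Om 2%:E f ->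
  {ae mu, forall x : T, Om x -> Res f x = green_op Om G (fun y => f y + l * Res f y) x}.
Proof.
case: Gcpt => h1 h2 h3; case: Geig => _ h4 [h5 h6] h7 h8.
exact: (@resolvent_fixpoint _ T R mu Om mOm finOm (green_op Om G) lam phi
  h1 h2 eigenval_gt0 h5 h6 h7 h8 l laml Res resolvent_inLp2 ResE).
Qed.

(** The sup estimate in pointwise a.e. form. The constant of (A5) carries no sign, hence the
    absolute value. *)
Lemma resolvent_bounded f M : 0 <= M -> measurable_fun (Om : set T) (f : T -> R) ->
  {ae mu, forall x : T, Om x -> `|f x| <= M} ->
  {ae mu, forall x : T, Om x -> `|Res f x| <= `|C| * M}.
Proof.
move=> M0 mf fM; have foo : inLp Om +oo%E f by apply/inLpyP; split=> //; exists M.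
apply/(Lnormy_patch_le mu Om (Res f) (mulr_ge0 (normr_ge0 C) M0)).
have /(Lnormy_patch_le mu Om f M0) fM' := fM.
apply: (le_trans (Resoo foo)); rewrite EFinM.
apply: (@le_trans _ _ (`|C|%:E * normLp Om +oo%E f)%E).
  by apply: lee_wpmul2r; [exact: Lnorm_ge0|rewrite lee_fin ler_norm].
by apply: lee_wpmul2l; rewrite ?lee_fin.
Qed.

Lemma resolvent_inLpy f : inLp Om +oo%E f -> inLp Om +oo%E (Res f).
Proof.
move=> foo; have [mf [M M0 fM]] := (inLpyP f).1 foo; apply/inLpyP; split.
  by apply: inLp2_measurable; apply: resolvent_inLp2; exact: inLpy2.
by exists (`|C| * M); [rewrite mulr_ge0|exact: resolvent_bounded].
Qed.

Lemma green_op_bdist : exists2 A, 0 <= A & forall f M, 0 <= M ->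
  measurable_fun (Om : set T) (f : T -> R) ->
  {ae mu, forall x : T, Om x -> `|f x| <= M} ->
  forall x, Om x -> `|green_op Om G f x| <= A * M * bdist Om x `^ gam.
Proof.
have [A A0 AG] := green_integral_le Om_bounded Om_open mG gam0 gam2s s2dim GK1.
exists A => // f M M0 mf fM x Ox.
have Gi : mu.-integrable Om (EFin \o (G x : T -> R)).
  apply/integrableP; split; first by apply/measurable_EFinP; exact: mG.
  by apply: le_lt_trans (AG x Ox) _; rewrite ltry.
have Gx1 : inLp Om 1%E (G x) by apply/inLp1P.
apply: (le_trans (dot_le_L1_Loo mOm Gx1 mf M0 fM)).
rewrite mulrAC mulrC ler_wpM2r// -lee_fin (EFin_Rintegral mOm); first exact: AG.
exact: integrable_normr Gi.
Qed.

Lemma resolvent_bdist : exists2 A, 0 <= A & forall f M, 0 <= M ->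
  measurable_fun (Om : set T) (f : T -> R) ->
  {ae mu, forall x : T, Om x -> `|f x| <= M} ->
  {ae mu, forall x : T, Om x -> `|Res f x| <= A * M * bdist Om x `^ gam}.
Proof.
have [A A0 AG] := green_op_bdist.
(* The source [f + l * Res f] of the fixed point equation is bounded by (1 + |l| |C|) M. *)
exists (A * (1 + `|l| * `|C|)); first by rewrite mulr_ge0// addr_ge0// mulr_ge0.
move=> f M M0 mf fM; have foo : inLp Om +oo%E f by apply/inLpyP; split=> //; exists M.
have f2 := inLpy2 foo; have mR := inLp2_measurable (resolvent_inLp2 f2).
have M'0 : 0 <= (1 + `|l| * `|C|) * M by rewrite mulr_ge0// addr_ge0// mulr_ge0.
have FM : {ae mu, forall x : T, Om x -> `|f x + l * Res f x| <= (1 + `|l| * `|C|) * M}.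
  apply: filterS2 fM (resolvent_bounded M0 mf fM) => x h1 h2 Ox.
  rewrite (le_trans (ler_normD _ _))// mulrDl mul1r lerD ?h1// normrM -mulrA.
  by rewrite ler_wpM2l// h2.
have mF : measurable_fun (Om : set T) ((fun x => f x + l * Res f x) : T -> R).
  apply: inLp2_measurable.
  apply: (@Lfun2_add _ T R mu Om mOm f (fun x => l * Res f x)) => //.
  exact: (@Lfun2_scale _ T R mu Om mOm l (Res f) (resolvent_inLp2 f2)).
apply: filterS (resolvent_green f2) => x h Ox.
by rewrite h// -(mulrA A); exact: AG.
Qed.

(* Duality: test Res f - Res g against its sign, whose resolvent is O(delta^gam). *)
Lemma resolvent_weighted_L1 : exists2 A, 0 <= A & forall f g,
  inLp Om 2%:E f -> inLp Om 2%:E g ->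
  (\int[mu]_(x in Om) `|Res f x - Res g x| <=
   A * \int[mu]_(x in Om) (`|f x - g x| * bdist Om x `^ gam))%R.
Proof.
have [A A0 AR] := resolvent_bdist; exists A => // f g f2 g2.
have Rf2 := resolvent_inLp2 f2; have Rg2 := resolvent_inLp2 g2.
have fg2 : inLp Om 2%:E (f \- g) by exact: (Lfun2_sub mOm).
have Rfg2 : inLp Om 2%:E (Res f \- Res g) by exact: (Lfun2_sub mOm).
have [psi [mpsi psi1 psiE]] := sign_test_function mOm (inLp2_measurable Rfg2).
have psi1' : {ae mu, forall x : T, Om x -> `|psi x| <= 1} by apply: nearW => x _; exact: psi1.
have psioo : inLp Om +oo%E psi by apply/inLpyP; split=> //; exists 1.
have psi2 := inLpy2 psioo.
have -> : (\int[mu]_(x in Om) `|Res f x - Res g x| = dot (Res f \- Res g) psi)%R.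
  by apply: eq_Rintegral => x /set_mem Ox; rewrite -psiE.
have -> : dot (Res f \- Res g) psi = dot (f \- g) (Res psi).
  have i2 := @Lfun2_mul_integrable _ T R mu Om mOm.
  rewrite /dotL2 (dot_sub mOm)//; [|exact: i2..].
  rewrite (dot_sub mOm)//; [|by apply: i2 => //; exact: resolvent_inLp2..].
  by have := resolvent_dotC f2 psi2; have := resolvent_dotC g2 psi2; rewrite /dotL2 => -> ->.
have Rpsi := AR psi 1 ler01 mpsi psi1'.
have wi : mu.-integrable Om (EFin \o (fun x : T => `|f x - g x| * bdist Om x `^ gam)).
  apply: integrable_mul_1y; last exact/bdist_powR_inLpy/ltW.
  apply/inLp1P; apply: (@integrable_normr _ T R mu Om (f \- g)); apply/inLp1P; exact: inLp21.
have Ri : mu.-integrable Om (EFin \o (fun x : T => (f \- g) x * Res psi x)).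
  by apply: (Lfun2_mul_integrable mOm) => //; exact: resolvent_inLp2.
apply: (le_trans (ler_norm _)); apply: (le_trans (le_normr_Rintegral mOm Ri)).
rewrite -RintegralZl//; apply: (ae_le_Rintegral mOm).
- exact: integrable_normr Ri.
- exact: integrable_EFinZ.
apply: filterS Rpsi => x h Ox; rewrite normrM mulrCA ler_wpM2l//.
by have := h Ox; rewrite mulr1.
Qed.

(** Truncations of [f] converge in L^1, hence in the weighted norm since delta^gam is bounded on
    [Om]. By [resolvent_weighted_L1] their resolvents are Cauchy in L^1, and the limit does not
    depend on the approximating sequence. The sequence [t] is returned too, as the symmetry is later
    passed to the limit along it. *)
Lemma resolvent_ext_exists f : inLp Om 1%E f ->
  exists (t : nat -> V -> R) (u : V -> R),
  [/\ forall k, inLp Om +oo%E (t k),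
      (\int[mu]_(x in Om) `|t k x - f x|)%R @[k --> \oo] --> (0 : R),
      normLp Om 1%E (fun x => (t k x - f x) * bdist Om x `^ gam) @[k --> \oo] --> 0%E &
      is_resolvent_ext Om gam lam phi l f u].
Proof.
move=> f1; have [A A0 wR] := resolvent_weighted_L1.
have [t [too' tf]] := Lfun1_truncation mOm f1.
have too k : inLp Om +oo%E (t k) by exact: too'.
pose w x := bdist Om x `^ gam.
have w0 x : 0 <= w x by exact: powR_ge0.
have woo : inLp Om +oo%E w by exact/bdist_powR_inLpy/ltW.
pose N (g1 g2 : V -> R) := (\int[mu]_(x in Om) (`|g1 x - g2 x| * w x))%R.
have Ni (g1 g2 : V -> R) : inLp Om 1%E g1 -> inLp Om 1%E g2 ->
    mu.-integrable Om (EFin \o (fun x : T => `|g1 x - g2 x| * w x)).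
  move=> g11 g21; apply: (@integrable_mul_1y (fun x => `|g1 x - g2 x|)) => //.
  apply/inLp1P; apply: (@integrable_normr _ T R mu Om (g1 \- g2)); apply/inLp1P.
  exact: (Lfun1_sub mOm).
have Nsym (g1 g2 : V -> R) : N g1 g2 = N g2 g1.
  by apply: eq_Rintegral => x _; rewrite distrC.
have Ntri (g1 g2 g3 : V -> R) : inLp Om 1%E g1 -> inLp Om 1%E g2 -> inLp Om 1%E g3 ->
    N g1 g3 <= N g1 g2 + N g2 g3.
  move=> h1 h2 h3; rewrite /N -(RintegralD mOm); [|exact: Ni..].
  apply: (le_Rintegral mOm); [exact: Ni|by apply: (integrable_EFinD mOm); exact: Ni|].
  by move=> x _; rewrite -mulrDl ler_wpM2r//; exact: ler_distD.
have N0 (g1 g2 : V -> R) : 0 <= N g1 g2.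
  by apply: Rintegral_ge0 => x _; rewrite mulr_ge0.
have normN (g : V -> R) : inLp Om 1%E g ->
    normLp Om 1%E (fun x => (g x - f x) * w x) = (N g f)%:E.
  move=> g1; rewrite normLp1E.
    by congr EFin; apply: eq_Rintegral => x _; rewrite normrM (ger0_norm (w0 x)).
  apply/inLp1P; apply: (@integrable_mul_1y (g \- f)) => //; exact: (Lfun1_sub mOm).
have t2 k : inLp Om 2%:E (t k) by exact: inLpy2 (too k).
have t1 k : inLp Om 1%E (t k) by exact: inLp21 (t2 k).
have Ntf : N (t k) f @[k --> \oo] --> (0 : R).
  have [mw [W W0 wW]] := (inLpyP w).1 woo.
  have WT : W * (\int[mu]_(x in Om) `|t k x - f x|)%R @[k --> \oo] --> (W * 0 : R).
    by apply: cvgM => //; exact: cvg_cst.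
  rewrite mulr0 in WT; apply: (squeeze_cvgr _ (cvg_cst 0) WT); apply: nearW => k.
  rewrite N0/=.
  have tfi : mu.-integrable Om (EFin \o (fun x : T => `|t k x - f x|)).
    apply: (@integrable_normr _ T R mu Om (t k \- f)); apply/inLp1P.
    exact: (@Lfun1_sub _ T R mu Om mOm _ _ (t1 k) f1).
  rewrite -RintegralZl//; apply: (ae_le_Rintegral mOm); [exact: Ni|exact: (integrable_EFinZ mOm)|].
  apply: filterS wW => x h Ox; rewrite mulrC ler_wpM2r//.
  by rewrite -(ger0_norm (w0 x)) h.
pose a k := A * N (t k) f.
have a0 : a @ \oo --> (0 : R).
  by rewrite -(mulr0 A); apply: cvgM => //; exact: cvg_cst.
have R1 g : inLp Om 2%:E g -> inLp Om 1%E (Res g).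
  by move=> g2; apply: inLp21; exact: resolvent_inLp2.
have [|||u ui ule] := @L1_complete _ T R mu Om mOm (fun k => Res (t k)) a.
- by move=> k; apply/inLp1P; exact: R1.
- exact: a0.
- move=> i j; apply: (le_trans (wR _ _ (t2 i) (t2 j))); rewrite /a -mulrDr ler_wpM2l//.
  by rewrite (Nsym (t j)); exact: Ntri.
have u1 : inLp Om 1%E u by apply/inLp1P.
exists t, u; split => //.
  have : (N (t k) f)%:E @[k --> \oo] --> 0%:E by apply: cvg_EFin => //; exact: nearW.
  by apply: cvg_trans; apply: near_eq_cvg; apply: nearW => k; rewrite -normN.
split=> // fk fk2 hfk.
have fk1 k : inLp Om 1%E (fk k) by exact: inLp21.
have {}hfk : N (fk k) f @[k --> \oo] --> (0 : R).
  have : (N (fk k) f)%:E @[k --> \oo] --> 0%:E.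
    by apply: cvg_trans hfk; apply: near_eq_cvg; apply: nearW => k; rewrite -normN.
  exact: fine_cvg.
have RE k : resolvent_L2 Om lam phi l (fk k) = Res (fk k).
  by rewrite /resolvent asboolT.
have E k : normLp Om 1%E (resolvent_L2 Om lam phi l (fk k) \- u) =
    (\int[mu]_(x in Om) `|Res (fk k) x - u x|)%R%:E.
  by rewrite RE (normLp1E (@Lfun1_sub _ T R mu Om mOm _ _ (R1 _ (fk2 k)) u1)).
have le k : (\int[mu]_(x in Om) `|Res (fk k) x - u x|)%R <= A * N (fk k) f.
  (* An arbitrary sequence [fk] is compared with one late truncation [t m], whose two contributions
     are at most e/2 each. *)
  apply/ler_addgt0Pr => e e0; have e2 : 0 < e / 2 by rewrite divr_gt0.
  have [m am] := cvg0_exists_le a0 e2.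
  apply: (le_trans (@Rintegral_dist_triangle _ T R mu Om mOm (Res (fk k)) (Res (t m)) u _ _ ui)).
  - by apply/inLp1P; exact: R1.
  - by apply/inLp1P; exact: R1.
  apply: (le_trans (lerD (wR _ _ (fk2 k) (t2 m)) (ule m))).
  apply: (@le_trans _ _ (A * (N (fk k) f + N f (t m)) + a m)).
    by rewrite lerD2r ler_wpM2l//; exact: Ntri.
  rewrite mulrDr (Nsym f) -/(a m) -addrA lerD2l; lra.
have AN : A * N (fk k) f @[k --> \oo] --> (0 : R).
  by rewrite -(mulr0 A); apply: cvgM => //; exact: cvg_cst.
have h0 : (\int[mu]_(x in Om) `|Res (fk k) x - u x|)%R @[k --> \oo] --> (0 : R).
  apply: (squeeze_cvgr _ (cvg_cst 0) AN); apply: nearW => k.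
  by rewrite le andbT; apply: Rintegral_ge0.
have : (\int[mu]_(x in Om) `|Res (fk k) x - u x|)%R%:E @[k --> \oo] --> 0%:E.
  by apply: cvg_EFin => //; exact: nearW.
by apply: cvg_trans; apply: near_eq_cvg; apply: nearW => k; rewrite E.
Qed.

(** [resolvent] has two branches. On L^2 the symmetry is spectral; on the other branch it passes to
    the limit along bounded truncations, as [psi] and [Res psi] are both bounded. *)
Lemma resolvent_L1_dot f : inLp Om 1%E f -> inLp Om 1%E (Res f) /\
  forall psi, inLp Om +oo%E psi -> dot (Res f) psi = dot f (Res psi).
Proof.
move=> f1; have [f2|f2] := pselect (inLp Om 2%:E f).
  split; first by apply: inLp21; exact: resolvent_inLp2.
  by move=> psi psioo; apply: resolvent_dotC => //; exact: inLpy2.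
have [t [u [too tf twf uext]]] := resolvent_ext_exists f1.
have [Rf1 Rext] : is_resolvent_ext Om gam lam phi l f (Res f).
  by rewrite /resolvent asboolF//; apply: getPex; exists u.
split => // psi psioo.
have t2 k : inLp Om 2%:E (t k) by exact: inLpy2.
have R1 k : inLp Om 1%E (Res (t k)).
  by apply: inLp21; exact: resolvent_inLp2.
have Rt := Rext t t2 twf.
have {}Rt : (\int[mu]_(x in Om) `|Res (t k) x - Res f x|)%R @[k --> \oo] --> (0 : R).
  have : (\int[mu]_(x in Om) `|Res (t k) x - Res f x|)%R%:E @[k --> \oo] --> 0%:E.
    apply: cvg_trans Rt; apply: near_eq_cvg; apply: nearW => k.
    rewrite (_ : resolvent_L2 Om lam phi l (t k) = Res (t k)).
      by rewrite (normLp1E (@Lfun1_sub _ T R mu Om mOm _ _ (R1 k) Rf1)).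
    by rewrite /resolvent asboolT.
  exact: fine_cvg.
have h1 : dot (Res (t k)) psi @[k --> \oo] --> dot (Res f) psi.
  by apply: (@dot_cvg_L1 _ T R mu Om mOm) => //; exact: nearW.
have h2 : dot (t k) (Res psi) @[k --> \oo] --> dot f (Res psi).
  apply: (@dot_cvg_L1 _ T R mu Om mOm) => //; last exact: resolvent_inLpy.
  by apply: nearW => k; exact: inLp21.
apply: (cvg_unique (@Rhausdorff R) h1); apply: cvg_trans h2.
apply: near_eq_cvg; apply: nearW => k; rewrite /= resolvent_dotC//; exact: inLpy2.
Qed.

End resolvent_on_domain.

(** * Perturbation of the limit operator: spectrum and coefficients *)

Section perturbation.
Context (R : realType) (n : nat) (Om : set 'rV[R]_n.+1).
Local Notation V := 'rV[R]_n.+1.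
Local Notation T := (lebesgue_mspace R n).
Local Notation mu := (lebesgue_measure_rV R n).
Local Notation dot := (dotL2 Om).
Hypothesis Om_bounded : bounded_set Om.
Hypothesis Om_open : open Om.

Let mOm := measurable_domain Om_open.
Let finOm := lebesgue_domain_lty Om_bounded.

Lemma normLp2E (f : V -> R) : inLp Om 2%:E f ->
  normLp Om 2%:E f = (Num.sqrt (dot f f))%:E.
Proof. by move=> /(Lfun2_patch mu mOm)[_ fi]; exact: (Lnorm2_patch mOm fi). Qed.

Context (l : R) (G : V -> V -> R) (lam : nat -> R) (phi : nat -> V -> R).
Hypothesis Gcpt : compact_selfadjoint_L2 Om (green_op Om G).
Hypothesis Geig : eigenbasis Om G lam phi.
Hypothesis laml : forall j, lam j != l.

Let phi2 j : inLp Om 2%:E (phi j). Proof. by case: Geig => _ _ []. Qed.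

Let int2 (f g : V -> R) : inLp Om 2%:E f -> inLp Om 2%:E g ->
  mu.-integrable Om (EFin \o (fun x : T => f x * g x)).
Proof. exact: (Lfun2_mul_integrable mOm). Qed.

Let dot_green (f : V -> R) j : inLp Om 2%:E f ->
  dot (green_op Om G f) (phi j) = dot f (phi j) / lam j.
Proof.
case: Gcpt => h1 h2 _; case: (Geig) => _ _ [h5 _] _ h8.
exact: (@dot_eigenfun _ T R mu Om mOm (green_op Om G) lam phi h1 h2 (eigenval_gt0 Geig) h5 h8).
Qed.

Let bessel_phi (f : V -> R) N : inLp Om 2%:E f -> \sum_(j < N) dot f (phi j) ^+ 2 <= dot f f.
Proof.
case: (Geig) => _ _ [h5 _] h7 _; exact: (@bessel _ T R mu Om mOm finOm phi h5 h7).
Qed.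

Let parseval_phi (f : V -> R) : inLp Om 2%:E f ->
  \sum_(j < N) dot f (phi j) * dot f (phi j) @[N --> \oo] --> dot f f.
Proof.
by move=> f2; case: (Geig) => _ _ [h5 _] h7 _; exact: (@parseval _ T R mu Om mOm finOm phi h5 h7).
Qed.

Let dot_dist_le (e F : V -> R) (w : R) : inLp Om 2%:E e -> inLp Om 2%:E F ->
  (normLp Om 2%:E e <= w%:E * normLp Om 2%:E F)%E ->
  Num.sqrt (dot e e) <= w * Num.sqrt (dot F F).
Proof. by move=> e2 F2; rewrite !normLp2E// -EFinM lee_fin. Qed.

(** If p = m K p with m = l, the coefficients of (K - G) p are those of p times 1/m - 1/lam_j, of
    modulus |lam_j - l| / (lam_j m) >= r/m. Parseval gives r/m <= w, so k = r/(|l| + 1) < r/m is a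
    contradiction. As [K] is arbitrary, one k serves all s. *)
Lemma eigenvalue_stable : exists2 k, 0 < k &
  forall (K : (V -> R) -> V -> R) (m w : R) (p : V -> R),
    0 < m -> inLp Om 2%:E p -> inLp Om 2%:E (K p) -> dot p p = 1 ->
    {ae mu, forall x : T, Om x -> p x = m * K p x} ->
    (normLp Om 2%:E (K p \- green_op Om G p)%R <= w%:E * normLp Om 2%:E p)%E ->
    w < k -> m != l.
Proof.
have lam0 := eigenval_gt0 Geig; have [_ lamoo _ _ _] := Geig.
have [r r0 rP] := spectral_gap lam0 lamoo laml.
exists (r / (`|l| + 1)); first by rewrite divr_gt0// ltr_wpDl.
move=> K m w p m0 p2 Kp2 pp pE wle wk; apply/eqP => ml.
have Gp2 : inLp Om 2%:E (green_op Om G p) by case: Gcpt => h _ _; exact: h.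
pose e : V -> R := K p \- green_op Om G p.
have e2 : inLp Om 2%:E e by exact: (@Lfun2_sub _ T R mu Om mOm _ _ Kp2 Gp2).
have := dot_dist_le e2 p2 wle; rewrite pp sqrtr1 mulr1 => ew.
have Kpj j : dot (K p) (phi j) = dot p (phi j) / m.
  have -> : dot p (phi j) = m * dot (K p) (phi j).
    rewrite -(dot_scale mOm); last exact: int2.
    have mKp2 : inLp Om 2%:E (fun x => m * K p x).
      exact: (@Lfun2_scale _ T R mu Om mOm m (K p) Kp2).
    exact: (@dot_ae_eql _ T R mu Om mOm p (fun x => m * K p x) _ p2 mKp2 (phi2 j) pE).
  by rewrite mulrC mulKf// gt_eqF.
have ej j : dot e (phi j) = dot p (phi j) * (m^-1 - (lam j)^-1).
  by rewrite /dotL2 (dot_sub mOm); [|exact: int2..]; have := Kpj j; have := dot_green j p2; rewrite /dotL2 => -> ->; rewrite mulrBr.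
have pe : (r / m) ^+ 2 <= dot e e.
  have h : (r / m) ^+ 2 * \sum_(j < N) dot p (phi j) * dot p (phi j) @[N --> \oo] -->
      ((r / m) ^+ 2 * dot p p : R).
    by apply: cvgM; [exact: cvg_cst|exact: parseval_phi].
  rewrite pp mulr1 in h; rewrite -(cvg_lim (@Rhausdorff R) h).
  apply: limr_le; first by apply/cvg_ex; exists ((r / m) ^+ 2).
  apply: nearW => N; apply: (le_trans _ (bessel_phi N e2)).
  rewrite mulr_sumr; apply: ler_sum => j _.
  have lj := lam0 j.
  have rmj : (r / m) ^+ 2 <= (m^-1 - (lam j)^-1) ^+ 2.
    rewrite -(real_normK (num_real (m^-1 - _))) lerXn2r ?nnegrE//.
      by rewrite divr_ge0 ?ltW.
    have -> : m^-1 - (lam j)^-1 = (lam j - l) / lam j / m.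
      by rewrite -ml; field; rewrite !gt_eqF.
    rewrite normrM normfV (gtr0_norm m0) ler_pM2r ?invr_gt0//.
    by rewrite normrM normfV (gtr0_norm lj) ler_pdivlMr.
  rewrite -expr2 [leLHS]mulrC ej [leRHS]exprMn.
  by apply: ler_wpM2l rmj; exact: sqr_ge0.
have {}pe : r / m <= w.
  have rm0 : 0 <= r / m by rewrite divr_ge0 ?ltW.
  by apply: le_trans ew; rewrite -(ger0_norm rm0) -sqrtr_sqr; exact: ler_wsqrtr.
move: (le_lt_trans pe wk); rewrite -ml (gtr0_norm m0) ltr_pM2l//.
rewrite ltf_pV2 ?posrE// => [h|]; lra.
Qed.

(** Put e = (K - G) F. Since u = K F, pairing e with phi_j gives (1 - l/lam_j) <u, phi_j> - <psi,
    phi_j>/lam_j. Multiplying by lam_j/(lam_j - l) isolates the difference of coefficients, and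
    Cauchy-Schwarz bounds <e, phi_j>. *)
Lemma resolvent_coef_dist (K : (V -> R) -> V -> R) (psi u : V -> R) (w : R) (j : nat) :
  let F : V -> R := fun x => psi x + l * u x in
  inLp Om 2%:E psi -> inLp Om 2%:E u -> inLp Om 2%:E (K F) ->
  {ae mu, forall x : T, Om x -> u x = K F x} ->
  (normLp Om 2%:E (K F \- green_op Om G F)%R <= w%:E * normLp Om 2%:E F)%E ->
  `|dot u (phi j) - dot psi (phi j) / (lam j - l)| <=
    lam j / `|lam j - l| * (w * Num.sqrt (dot F F)).
Proof.
move=> F psi2 u2 KF2 uE wle; have lj := eigenval_gt0 Geig j.
have F2 : inLp Om 2%:E F.
  by apply: (Lfun2_add mOm) => //; exact: (Lfun2_scale mOm).
have GF2 : inLp Om 2%:E (green_op Om G F) by case: Gcpt => h _ _; exact: h.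
pose e : V -> R := K F \- green_op Om G F.
have e2 : inLp Om 2%:E e by exact: (@Lfun2_sub _ T R mu Om mOm _ _ KF2 GF2).
have ew := dot_dist_le e2 F2 wle.
have ej : dot e (phi j) = dot u (phi j) - (dot psi (phi j) + l * dot u (phi j)) / lam j.
  have -> : dot u (phi j) = dot (K F) (phi j) by exact: (dot_ae_eql mOm u2 KF2 (phi2 j) uE).
  have -> : dot psi (phi j) + l * dot (K F) (phi j) = dot F (phi j).
    have -> : dot (K F) (phi j) = dot u (phi j) by rewrite /dotL2 (dot_ae_eql mOm u2 KF2 (phi2 j) uE).
    have -> : dot F (phi j) = dot (fun x => 1 * psi x + l * u x) (phi j).
      by apply: eq_Rintegral => x _; rewrite mul1r.
    by rewrite /dotL2 (dot_lin mOm) ?mul1r//; exact: int2.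
  rewrite -dot_green// /dotL2 (dot_sub mOm)//; exact: int2.
have llj : lam j - l != 0 by rewrite subr_eq0.
have -> : dot u (phi j) - dot psi (phi j) / (lam j - l) = lam j / (lam j - l) * dot e (phi j).
  by rewrite ej; field; rewrite llj gt_eqF.
rewrite !normrM normfV (gtr0_norm lj) ler_wpM2l//.
  by rewrite divr_ge0// ltW.
apply: le_trans ew; apply: (le_trans (dot_normr_le mOm e2 (phi2 j))).
have [_ _ [_ orth] _ _] := Geig.
by have := orth j j; rewrite /dotL2 eqxx => ->; rewrite sqrtr1 mulr1.
Qed.

End perturbation.

(** * Passage to the limit s -> 1 *)

Lemma near_at_right0_left1 (R : realType) (P : set R) :
  (\forall t \near 0^'+, P t) -> \forall s \near 1^'-, P (1 - s).
Proof.
move=> /nbhs_ballP[e /= e0 eP]; apply/nbhs_ballP; exists e => //= s.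
rewrite /ball/= => se s1; apply: eP; last by rewrite /= subr_gt0.
by rewrite /ball/= sub0r normrN.
Qed.

Lemma near_left1_gt (R : realType) (a : R) : a < 1 -> \forall s \near 1^'-, a < s.
Proof.
move=> a1; apply/nbhs_ballP; exists (1 - a); rewrite /= ?subr_gt0// => s.
by rewrite /ball/= ltr_norml => /andP[_ h] _; lra.
Qed.

Theorem proposition8p5 (R : realType) (n : nat) (Om : set 'rV[R]_n.+1)
    (Om_bounded : bounded_set Om) (Om_C11 : C11_domain Om)
    (L : op_family R n) (HL : standing Om L)
    (H0 : A0 Om L) (H1 : A1 Om L) (H2 : A2 L)
    (H3 : A3 Om L) (H4 : A4 Om L) (H5 : A5 Om L)
    (lambda : R) (hlambda : ~ Sigma L 1 lambda)
    (g : 'rV[R]_n.+1 -> R) (hg : inLp Om 2%:E g)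
    (h : 'rV[R]_n.+1 -> R) (hh : inLinfty_boundary Om h) :
  weak_cvg_L1 Om 1^'- (solution Om L lambda g h) (solution Om L lambda g h 1).
Proof.
have [Om_open _] := Om_C11.
pose mu := lebesgue_measure_rV R n; pose T := lebesgue_mspace R n.
have mOm := measurable_domain Om_open; have finOm := lebesgue_domain_lty Om_bounded.
have s01 : 0 < (1 : R) <= 1 by rewrite ltr01 lexx.
(* The condition dim != 2s in (K1) excludes dimension 2 at s = 1 and dimension 1 at s = 1/2; hence
   2s < dim for every s <= 1. *)
have dim3 : 2 < n.+1%:R :> R.
  have [_ [d1 _ _ _] _] := H0 1 s01.
  have half : 0 < (2^-1 : R) <= 1 by rewrite invr_gt0 ltr0n invf_le1 ?ler1n.
  have [_ [d2 _ _ _] _] := H0 2^-1 half.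
  move: d1 d2; rewrite mulr1 mulfV// !(eqr_nat R) ltr_nat.
  by rewrite (_ : 1 = 1%:R) ?eqr_nat//; case: (n) => [|[|]].
have [C [s0 [s0lt A5C]]] := H5 _ hlambda.
have [om [_ om0 omle]] := H1.
(* What the fixed-s results require. It holds at s = 1 and for s near 1 with the same [C], so they
   apply along the filter and at the limit. *)
pose good s := [/\ 0 < s <= 1, gamma L s < 2 * s,
  forall j, eigenval L s j != lambda &
  forall f, inLp Om +oo%E f ->
    (normLp Om +oo%E (Gres Om L s lambda f) <= C%:E * normLp Om +oo%E f)%E].
have good1 : good 1.
  split=> //.
  - by have [/andP[_ g1] _ _] := H0 1 s01; lra.
  - by move=> j; apply/eqP => jl; apply: hlambda; exists j.
  - by move=> f foo; apply: A5C.
have [_ Gcpt1 Geig1] := HL 1 s01.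
have [_ _ laml1 _] := good1.
have [k k0 kP] := eigenvalue_stable Om_bounded Om_open Gcpt1 Geig1 laml1.
have om_small e : 0 < e -> \forall s \near 1^'-, om (1 - s) < e.
  move=> e0; apply: (@near_at_right0_left1 R (fun t => om t < e)).
  move/cvgrPdist_lt: om0 => /(_ _ e0); apply: filterS => t.
  by rewrite sub0r normrN; exact: le_lt_trans (ler_norm _).
have near_lt1 : \forall s \near (1 : R)^'-, s < 1 by exact: nbhs_left_lt.
have near_gt0 : \forall s \near (1 : R)^'-, 0 < s by exact: near_left1_gt.
have near_good : \forall s \near 1^'-, good s.
  have near_s0 := near_left1_gt s0lt; have near_k := om_small _ k0.
  near=> s.
  have sgt0 : 0 < s by near: s.
  have slt1 : s < 1 by near: s.
  have s01' : 0 < s <= 1 by rewrite sgt0 ltW.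
  have s01'' : 0 < s < 1 by rewrite sgt0.
  split=> //; first by near: s.
  - move=> j; have [_ Gcpts Geigs] := HL s s01'.
    have [_ _ [p2 orth] _ peig] := Geigs.
    have K2 : inLp Om 2%:E (Gop Om L s (eigenfun L s j)) by case: Gcpts => K2 _ _; exact: K2.
    (* (A1), applied to a normalized eigenfunction of L_s, shows that its eigenvalue is not
       lambda. *)
    apply: (kP (Gop Om L s) _ (om (1 - s)) (eigenfun L s j)) => //.
    + exact: (eigenval_gt0 Geigs).
    + by have := orth j j; rewrite eqxx.
    + exact: omle.
    + by near: s.
  - by move=> f foo; apply: A5C.
have res_dot s : good s -> forall f, inLp Om 1%E f -> inLp Om 1%E (Gres Om L s lambda f) /\
    forall psi, inLp Om +oo%E psi ->
      dotL2 Om (Gres Om L s lambda f) psi = dotL2 Om f (Gres Om L s lambda psi).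
  move=> [s01' g2s laml Resoo].
  have [mG Gcpt Geig] := HL s s01'; have [/andP[g0 _] GK1 _] := H0 s s01'.
  have s2dim : 2 * s < n.+1%:R.
    by case/andP: s01' => _ s1; apply: le_lt_trans dim3; lra.
  exact: (resolvent_L1_dot Om_bounded Om_open mG Gcpt Geig g0 g2s s2dim GK1 laml Resoo).
have [Mnear M1 Mcvg] := H3 h hh.
have fL1 s : inLp Om 1%E (Mop Om L s h) ->
    inLp Om 1%E (g \+ (fun x => lambda * Mop Om L s h x)).
  move=> Ms; have g1 : inLp Om 1%E g by exact: (inLp21 Om_bounded Om_open).
  have -> : g \+ (fun x => lambda * Mop Om L s h x) =
      (fun x => 1 * g x + lambda * Mop Om L s h x).
    by apply/funext => x /=; rewrite mul1r.
  exact: (@Lfun1_lin _ T R mu Om mOm 1 lambda _ _ g1 Ms).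
have vL1 s : good s -> inLp Om 1%E (Mop Om L s h) -> inLp Om 1%E (solution Om L lambda g h s).
  move=> gs Ms; have [Rf1 _] := res_dot s gs _ (fL1 s Ms).
  have -> : solution Om L lambda g h s = (fun x => 1 * Mop Om L s h x +
      1 * Gres Om L s lambda (g \+ (fun x => lambda * Mop Om L s h x)) x).
    by apply/funext => x; rewrite !mul1r.
  exact: (@Lfun1_lin _ T R mu Om mOm 1 1 _ _ Ms Rf1).
split; [by apply: filterS2 near_good Mnear => s; exact: vL1|exact: (vL1 1 good1 M1)|].
move=> psi psioo.
pose u s := Gres Om L s lambda psi.
have [mpsi [M M0 psiM]] := (inLpyP Om_open psi).1 psioo.
have psi2 : inLp Om 2%:E psi by exact: (inLpy2 Om_bounded Om_open).
have u_spec s : good s -> [/\ inLp Om 2%:E (u s), inLp Om +oo%E (u s) &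
    {ae mu, forall x : T, Om x -> `|u s x| <= `|C| * M}].
  move=> [s01' g2s laml Resoo].
  have [mG Gcpt Geig] := HL s s01'.
  split.
  - exact: (resolvent_inLp2 Om_bounded Om_open (gamma L s) Gcpt Geig laml).
  - exact: (resolvent_inLpy Om_bounded Om_open Gcpt Geig laml Resoo).
  - exact: (resolvent_bounded Om_open Resoo).
have [u12 u1oo u1M] := u_spec 1 good1.
have Cm0 : 0 <= `|C| * M by rewrite mulr_ge0.
have near_u : \forall s \near 1^'-, measurable_fun (Om : set T) (u s : T -> R) /\
    {ae mu, forall x : T, Om x -> `|u s x| <= `|C| * M}.
  by apply: filterS near_good => s /u_spec[us2 _ usM]; split=> //; exact: (inLp2_measurable Om_open us2).
have [_ _ [phi2 _] phi_tot _] := Geig1.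
have coef_cvg j : dotL2 Om (eigenfun L 1 j) (u s) @[s --> 1^'-] -->
    dotL2 Om (eigenfun L 1 j) (u 1).
  apply/cvgrPdist_le => e e0.
  pose MF := M + `|lambda| * (`|C| * M).
  have MF0 : 0 <= MF by rewrite addr_ge0// mulr_ge0.
  (* A bound, uniform in s, for the L^2 norm of the source [psi + lambda * u s]. *)
  pose B := Num.sqrt (\int[mu]_(x in Om) MF ^+ 2)%R.
  have B0 : 0 <= B by exact: sqrtr_ge0.
  pose kap := eigenval L 1 j / `|eigenval L 1 j - lambda|.
  have kap0 : 0 <= kap by rewrite divr_ge0// ltW// (eigenval_gt0 Geig1).
  (* The final error is at most kap B times this number; the added ones keep the denominator
     positive if kap or B vanishes. *)
  have e'0 : 0 < e / ((kap + 1) * (B + 1)).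
    by rewrite divr_gt0// mulr_gt0// ltr_wpDl.
  apply: filterS3 near_good near_lt1 (om_small _ e'0) => s gs slt1 oms.
  have [us2 usoo usM] := u_spec s gs.
  have [s01' _ lamls _] := gs; have [_ Gcpts Geigs] := HL s s01'.
  pose F x := psi x + lambda * u s x.
  have F2 : inLp Om 2%:E F.
    apply: (@Lfun2_add _ T R mu Om mOm psi (fun x => lambda * u s x)) => //.
    exact: (@Lfun2_scale _ T R mu Om mOm lambda (u s) us2).
  have KF2 : inLp Om 2%:E (Gop Om L s F) by case: Gcpts => K2 _ _; exact: K2.
  have ufix : {ae mu, forall x : T, Om x -> u s x = Gop Om L s F x}.
    exact: (resolvent_green Om_bounded Om_open (gamma L s) Gcpts Geigs lamls psi2).
  have s01'' : 0 < s < 1 by case/andP: s01' => -> _.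
  have := @resolvent_coef_dist R n Om Om_open lambda _ _ _ Gcpt1 Geig1 laml1
    (Gop Om L s) psi (u s) (om (1 - s)) j psi2 us2 KF2 ufix (omle s s01'' F F2).
  (* The comparison value <psi, phi_j>/(lam_j - lambda) is the coefficient of [u 1]. *)
  rewrite -(resolvent_coefE Om_bounded Om_open (gamma L 1) Gcpt1 Geig1 laml1 j psi2).
  have dC f : dotL2 Om (eigenfun L 1 j) f = dotL2 Om f (eigenfun L 1 j) by exact: dotC.
  rewrite distrC !dC => /le_trans; apply.
  have FM : {ae mu, forall x : T, Om x -> `|F x| <= MF}.
    apply: filterS2 psiM usM => x h1 h2 Ox; rewrite (le_trans (ler_normD _ _))//.
    by rewrite lerD ?h1// normrM ler_wpM2l// h2.
  have FB : Num.sqrt (dotL2 Om F F) <= B.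
    rewrite ler_wsqrtr//; apply: (ae_le_Rintegral mOm).
    - exact: (Lfun2_mul_integrable mOm F2 F2).
    - exact: (integrable_cst_fin mOm finOm).
    apply: filterS FM => x FM Ox; rewrite -expr2 -(real_normK (num_real (F x))).
    by rewrite lerXn2r ?nnegrE// FM.
  apply: (@le_trans _ _ (kap * (e / ((kap + 1) * (B + 1)) * B))).
    rewrite ler_wpM2l//; apply: (@le_trans _ _ (e / ((kap + 1) * (B + 1)) * Num.sqrt (dotL2 Om F F))).
      by rewrite ler_wpM2r ?sqrtr_ge0// ltW.
    by rewrite ler_wpM2l// ltW.
  rewrite (_ : kap * _ = e * (kap * B) / ((kap + 1) * (B + 1))); last by ring.
  rewrite ler_pdivrMr ?mulr_gt0 ?ltr_wpDl// ler_wpM2l ?(ltW e0)//.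
  by apply: ler_pM => //; rewrite lerDl.
have weak f : inLp Om 1%E f -> dotL2 Om f (u s) @[s --> 1^'-] --> dotL2 Om f (u 1).
  exact: (@weak_cvg_of_coef _ T R mu Om mOm finOm (eigenfun L 1) R 1^'- _ u (u 1)
    (`|C| * M) Cm0 phi2 phi_tot near_u (inLp2_measurable Om_open u12) u1M coef_cvg).
have Mcvg' : (\int[mu]_(x in Om) `|Mop Om L s h x - Mop Om L 1 h x|)%R @[s --> 1^'-] --> (0 : R).
  apply: (@fine_cvg _ _ _ _ (fun s => (\int[mu]_(x in Om) `|Mop Om L s h x - Mop Om L 1 h x|)%R%:E)).
  apply: cvg_trans Mcvg; apply: near_eq_cvg; apply: filterS Mnear => s Ms.
  by rewrite (normLp1E Om_open (@Lfun1_sub _ T R mu Om mOm _ _ Ms M1)).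
have g1 : inLp Om 1%E g by exact: (inLp21 Om_bounded Om_open).
have lim1 : dotL2 Om (Mop Om L s h) psi @[s --> 1^'-] --> dotL2 Om (Mop Om L 1 h) psi.
  exact: (@dot_cvg_L1 _ T R mu Om mOm R 1^'- _ _ _ _ Mnear M1 psioo Mcvg').
have lim2 : dotL2 Om (Mop Om L s h) (u s) @[s --> 1^'-] --> dotL2 Om (Mop Om L 1 h) (u 1).
  (* The moving difference is killed by the uniform bound on [u s] and (A3); what remains pairs the
     fixed [Mop 1 h] with [u s], where [weak] applies. *)
  have d0 : dotL2 Om (Mop Om L s h \- Mop Om L 1 h) (u s) @[s --> 1^'-] --> (0 : R).
    have CM : `|C| * M * (\int[mu]_(x in Om) `|Mop Om L s h x - Mop Om L 1 h x|)%R
        @[s --> 1^'-] --> (`|C| * M * 0 : R) by apply: cvgM => //; exact: cvg_cst.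
    rewrite mulr0 in CM; apply: norm_cvg0; apply: (squeeze_cvgr _ (cvg_cst 0) CM).
    apply: filterS2 near_u Mnear => s [mus usM] Ms; rewrite normr_ge0/=.
    exact: (dot_le_L1_Loo mOm (@Lfun1_sub _ T R mu Om mOm _ _ Ms M1) mus Cm0 usM).
  have hlim : dotL2 Om (Mop Om L s h \- Mop Om L 1 h) (u s) + dotL2 Om (Mop Om L 1 h) (u s)
      @[s --> 1^'-] --> (0 + dotL2 Om (Mop Om L 1 h) (u 1) : R).
    exact: cvgD d0 (weak _ M1).
  rewrite add0r in hlim; apply: cvg_trans hlim.
  apply: near_eq_cvg; apply: filterS2 near_good Mnear => s gs Ms /=.
  have [_ usoo _] := u_spec s gs.
  have Msu := @Lfun1_mul_Lfuny_integrable _ T R mu Om mOm _ _ Ms usoo.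
  have M1u := @Lfun1_mul_Lfuny_integrable _ T R mu Om mOm _ _ M1 usoo.
  have E : dotL2 Om (Mop Om L s h \- Mop Om L 1 h) (u s) =
      dotL2 Om (Mop Om L s h) (u s) - dotL2 Om (Mop Om L 1 h) (u s).
    exact: (@dot_sub _ T R mu Om mOm _ _ _ Msu M1u).
  by rewrite E subrK.
(* Symmetry moves the resolvent onto [psi], leaving three pairings whose limits are known. The
   identity at s = 1 identifies the limit. *)
have vE s : good s -> inLp Om 1%E (Mop Om L s h) ->
    dotL2 Om (solution Om L lambda g h s) psi = dotL2 Om (Mop Om L s h) psi +
      (dotL2 Om g (u s) + lambda * dotL2 Om (Mop Om L s h) (u s)).
  move=> gs Ms; have [_ usoo _] := u_spec s gs.
  have [Rf1 Rdot] := res_dot s gs _ (fL1 s Ms).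
  pose f : 'rV[R]_n.+1 -> R := g \+ (fun x => lambda * Mop Om L s h x).
  have -> : dotL2 Om (solution Om L lambda g h s) psi =
      dotL2 Om (fun x => 1 * Mop Om L s h x + 1 * Gres Om L s lambda f x) psi.
    by apply: eq_Rintegral => x _; rewrite !mul1r.
  have Mpsi := @Lfun1_mul_Lfuny_integrable _ T R mu Om mOm _ _ Ms psioo.
  have Rpsi := @Lfun1_mul_Lfuny_integrable _ T R mu Om mOm _ _ Rf1 psioo.
  have -> : dotL2 Om (fun x => 1 * Mop Om L s h x + 1 * Gres Om L s lambda f x) psi =
      1 * dotL2 Om (Mop Om L s h) psi + 1 * dotL2 Om (Gres Om L s lambda f) psi.
    exact: (@dot_lin _ T R mu Om mOm 1 1 _ _ _ Mpsi Rpsi).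
  rewrite !mul1r (Rdot psi psioo); congr (_ + _).
  have -> : dotL2 Om f (u s) = dotL2 Om (fun x => 1 * g x + lambda * Mop Om L s h x) (u s).
    by apply: eq_Rintegral => x _; rewrite !mul1r.
  have gu := @Lfun1_mul_Lfuny_integrable _ T R mu Om mOm _ _ g1 usoo.
  have Mu := @Lfun1_mul_Lfuny_integrable _ T R mu Om mOm _ _ Ms usoo.
  rewrite -[X in _ = X + _]mul1r.
  exact: (@dot_lin _ T R mu Om mOm 1 lambda _ _ _ gu Mu).
have lim3 : lambda * dotL2 Om (Mop Om L s h) (u s) @[s --> 1^'-] -->
    lambda * dotL2 Om (Mop Om L 1 h) (u 1) by apply: cvgM => //; exact: cvg_cst.
have lim : dotL2 Om (Mop Om L s h) psi +
    (dotL2 Om g (u s) + lambda * dotL2 Om (Mop Om L s h) (u s)) @[s --> 1^'-] -->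
    (dotL2 Om (Mop Om L 1 h) psi +
      (dotL2 Om g (u 1) + lambda * dotL2 Om (Mop Om L 1 h) (u 1)) : R).
  exact: cvgD lim1 (cvgD (weak _ g1) lim3).
have cvg_near_eq (F G : R -> R) (a b : R) : a = b -> (\forall s \near 1^'-, F s = G s) ->
    G s @[s --> 1^'-] --> b -> F s @[s --> 1^'-] --> a.
  move=> -> FG; apply: cvg_trans; apply: near_eq_cvg.
  by apply: filterS FG => s ->.
apply: (cvg_near_eq _ _ _ _ (vE 1 good1 M1) _ lim).
by apply: filterS2 near_good Mnear; exact: vE.
Unshelve. all: by end_near. Qed.
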